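(* Suppose that the (infinite) sequence $\{(y^k,t_k,\lambda_k)\}_{k\ge 0}$ generated by the path-following gradient decomposition algorithm (described in the context) satisfies $\underline{t}:=\inf_{k\ge 0}t_k>0$. Then $$\lim_{k\to\infty}\|\nabla g(y^k;t_{k+1})\|_2=0.$$ Consequently, there exists a limit point $y^*$ of $\{y^k\}$ such that $y^*$ is a solution of $\min_{y\in\mathbb{R}^m}g(y;\underline{t})$.
   Context: Problem data: $m,N\ge 1$; for $i=1,\dots,N$, $\phi_i:\mathbb{R}^{n_i}\to\mathbb{R}$ is concave, $X_i\subset\mathbb{R}^{n_i}$ is a nonempty closed convex set, $A_i\in\mathbb{R}^{m\times n_i}$, $b_i\in\mathbb{R}^m$; $n=\sum_i n_i$, $A=[A_1,\dots,A_N]$, $b=\sum_i b_i$, $X=X_1\times\cdots\times X_N$, $\phi(x)=\sum_i\phi_i(x_i)$. The separable convex problem is $\phi^*=\max\{\phi(x): Ax=b,\ x\in X\}$. Standing assumptions. (A1) The solution set of this problem is nonempty; either $X$ is polyhedral or $\mathrm{ri}(X)\cap\{x: Ax=b\}\ne\emptyset$; the $\phi_i$ are proper, upper semicontinuous and concave; $A$ has full row rank. (A2) Each $X_i$ is bounded and is endowed with a self-concordant barrier $F_i$ (defined on $\mathrm{int}(X_i)\neq\emptyset$) with parameter $\nu_i>0$. It is also taken as standing that for every $t>0$ the smoothed dual problem $\min_{y\in\mathbb{R}^m} g(y;t)$ has a unique solution $y^*(t)$. Notation: $x_i^c=\arg\min_{\mathrm{int}(X_i)}F_i$, and $F_i$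 is normalized so that $F_i(x_i^c)=0$; $F(x)=\sum_iF_i(x_i)$. For $t>0$, $g(y;t)=\max_{x\in\mathrm{int}(X)}\{\phi(x)+y^T(Ax-b)-tF(x)\}$, whose unique maximizer is $x^*(y;t)$; $g(\cdot;t)$ is smooth and $\nabla g(y;t)=Ax^*(y;t)-b$ (gradient in $y$). For $x\in\mathrm{int}(X)$, $|\!|\!|A|\!|\!|_x^*:=\|A\nabla^2F(x)^{-1}A^T\|_2^{1/2}$. $\omega(\tau)=\tau-\ln(1+\tau)$ for $\tau\ge0$. Algorithm. Initialization: choose $t_0>0$ and $y^0\in\mathbb{R}^m$; set $x_0^*=x^*(y^0;t_0)$, $c_A^0=|\!|\!|A|\!|\!|^*_{x_0^*}$, $\lambda_0=\|\nabla g(y^0;t_0)\|_2$, $\omega_0=\omega(\lambda_0/c_A^0)$, $c_F^0=F(x_0^* )$. For $k=0,1,\dots$: (1) $t_{k+1}=t_k(1-\sigma_k)$ with $\sigma_k=\dfrac{\omega_k}{2(\omega_k+c_F^k)}$; (2) $x_k^*=x^*(y^k;t_{k+1})$ (for $k=0$ this replaces the initialization value) and $\nabla g(y^k;t_{k+1})=Ax_k^*-b$; (3) $\lambda_{k+1}=\|\nabla g(y^k;t_{k+1})\|_2$, $c_A^{k+1}=|\!|\!|A|\!|\!|^*_{x_k^*}$, $\omega_{k+1}=\omega(\lambda_{k+1}/c_A^{k+1})$, $c_F^{k+1}=F(x_k^* )$; (4) $\alpha_{k+1}=\dfrac{t_{k+1}}{c_A^{k+1}(c_A^{k+1}+\lambda_{k+1})}$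 and $y^{k+1}=y^k-\alpha_{k+1}\nabla g(y^k;t_{k+1})$. The practical stopping test (small $t$ and small gradient norm) is disregarded when considering the infinite sequence. *)

(* Defs.v *)
From HB Require Import structures.
From mathcomp Require Import all_boot all_order all_algebra.
From mathcomp Require Import all_classical all_reals all_analysis.
Import Order.TTheory GRing.Theory Num.Theory numFieldNormedType.Exports.

Set Implicit Arguments.
Unset Strict Implicit.
Unset Printing Implicit Defensive.

Local Open Scope classical_set_scope.
Local Open Scope ring_scope.

Definition argmax (R : realType) (T : Type) (D : set T) (f : T -> R) : set T :=
  [set x | D x /\ forall z, D z -> f z <= f x].

Definition argmin (R : realType) (T : Type) (D : set T) (f : T -> R) : set T :=
  [set x | D x /\ forall z, D z -> f x <= f z].

(* The library norm on matrices is the sup norm; it is only used for the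
   topology, for which the choice of a norm does not matter. *)
Definition norm2 (R : realType) (d : nat) (v : 'cV[R]_d) : R :=
  Num.sqrt (\sum_i v i ord0 ^+ 2).

Definition opnorm2 (R : realType) (d e : nat) (M : 'M[R]_(d, e)) : R :=
  sup [set norm2 (M *m v) | v in [set v : 'cV[R]_e | norm2 v <= 1]].

Definition grad (R : realType) (d : nat) (f : 'cV[R]_d -> R) (x : 'cV[R]_d) :
    'cV[R]_d :=
  \col_i 'D_(delta_mx i ord0) f x.

Definition hess (R : realType) (d : nat) (f : 'cV[R]_d -> R) (x : 'cV[R]_d) :
    'M[R]_d :=
  \matrix_(i, j) 'D_(delta_mx i ord0) ('D_(delta_mx j ord0) f) x.

Definition polyhedral (R : realType) (d : nat) (S : set 'cV[R]_d) : Prop :=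
  exists (k : nat) (C : 'M[R]_(k, d)) (r : 'cV[R]_k),
    S = [set x | forall j, (C *m x) j ord0 <= r j ord0].

Definition aff_hull (R : realType) (d : nat) (S : set 'cV[R]_d) :
    set 'cV[R]_d :=
  [set z | exists (k : nat) (c : 'I_k -> R) (p : 'I_k -> 'cV[R]_d),
     [/\ forall j, S (p j), \sum_j c j = 1 & z = \sum_j c j *: p j]].

Definition relint (R : realType) (d : nat) (S : set 'cV[R]_d) : set 'cV[R]_d :=
  [set x | S x /\
     exists2 e : R, 0 < e & ball x e `&` aff_hull S `<=` S].

(* [U] is meant to be open. *)
Fixpoint Cn_on (R : realType) (d : nat) (k : nat) (U : set 'cV[R]_d)
    (f : 'cV[R]_d -> R) : Prop :=
  (forall x, U x -> {for x, continuous f}) /\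
  (if k is k'.+1 then
     forall v : 'cV[R]_d,
       (forall x, U x -> derivable f x v) /\ Cn_on k' U ('D_v f)
   else True).

(* The values of [F] outside the interior of [X] are irrelevant: [F] stands for
   a function defined on the interior of [X] only.  The constant 2 in the
   third-derivative bound is that of a standard self-concordant function. *)
Record self_concordant_barrier (R : realType) (d : nat) (X : set 'cV[R]_d)
    (F : 'cV[R]_d -> R) (nu : R) : Prop := SelfConcordantBarrier {
  scb_convex : convex_function (interior X) F;
  scb_C3 : Cn_on 3 (interior X) F;
  scb_sc : forall x h : 'cV[R]_d, interior X x ->
    `|'D_h ('D_h ('D_h F)) x| <= 2 * ('D_h ('D_h F) x) `^ (3 / 2);
  scb_param : forall x h : 'cV[R]_d, interior X x ->
    2 * 'D_h F x - 'D_h ('D_h F) x <= nu;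
  scb_blowup : forall z : 'cV[R]_d, (X `\` interior X) z ->
    F x @[x --> within (interior X) (nbhs z)] --> +oo
}.

Record sep_problem (R : realType) (m N : nat) := SepProblem {
  dims : 'I_N -> nat;
  block_obj : forall i, 'cV[R]_(dims i) -> R;
  block_set : forall i, set 'cV[R]_(dims i);
  block_mat : forall i, 'M[R]_(m, dims i);
  block_rhs : 'I_N -> 'cV[R]_m;
  block_bar : forall i, 'cV[R]_(dims i) -> R
}.

Arguments block_obj {R m N} P i x : rename.
Arguments block_set {R m N} P i : rename.
Arguments block_mat {R m N} P i : rename.
Arguments block_rhs {R m N} P i : rename.
Arguments block_bar {R m N} P i x : rename.

Local Notation sp_point P := 'cV_(\sum_i dims P i).

Definition total_obj (R : realType) (m N : nat) (P : sep_problem R m N)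
    (x : sp_point P) : R :=
  \sum_i block_obj P i (submxcol x i).

Arguments total_obj {R m N} P x.

Definition feas_set (R : realType) (m N : nat) (P : sep_problem R m N) :
    set (sp_point P) :=
  [set x | forall i, block_set P i (submxcol x i)].

Arguments feas_set {R m N} P _.

Definition coupling_mx (R : realType) (m N : nat) (P : sep_problem R m N) :
    'M[R]_(m, \sum_i dims P i) :=
  \mxrow_i block_mat P i.

Definition coupling_rhs (R : realType) (m N : nat) (P : sep_problem R m N) :
    'cV[R]_m :=
  \sum_i block_rhs P i.

Definition total_bar (R : realType) (m N : nat) (P : sep_problem R m N)
    (x : sp_point P) : R :=
  \sum_i block_bar P i (submxcol x i).

Arguments total_bar {R m N} P x.

Definition solutions (R : realType) (m N : nat) (P : sep_problem R m N) :
    set (sp_point P) :=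
  argmax [set x | coupling_mx P *m x = coupling_rhs P /\ feas_set P x]
    (total_obj P).

Arguments solutions {R m N} P _.

Record problem_data (R : realType) (m N : nat) (P : sep_problem R m N) :
    Prop := ProblemData {
  pd_m : (0 < m)%N;
  pd_N : (0 < N)%N;
  pd_nonempty : forall i, block_set P i !=set0;
  pd_closed : forall i, closed (block_set P i);
  pd_convex : forall i, convex_set (block_set P i)
}.

(* Properness of the objectives is automatic, since they are real-valued. *)
Record assumption_A1 (R : realType) (m N : nat) (P : sep_problem R m N) :
    Prop := AssumptionA1 {
  A1_solvable : solutions P !=set0;
  A1_qualification : polyhedral (feas_set P) \/
    (relint (feas_set P) `&`
       [set x | coupling_mx P *m x = coupling_rhs P]) !=set0;
  A1_concave : forall i, convex_function setT (fun x => - block_obj P i x);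
  A1_usc : forall i, lower_semicontinuous (fun x => (- block_obj P i x)%:E);
  A1_rank : row_free (coupling_mx P)
}.

Record assumption_A2 (R : realType) (m N : nat) (P : sep_problem R m N)
    (nu : 'I_N -> R) : Prop := AssumptionA2 {
  A2_bounded : forall i, bounded_set (block_set P i);
  A2_interior : forall i, interior (block_set P i) !=set0;
  A2_nu : forall i, 0 < nu i;
  A2_barrier : forall i,
    self_concordant_barrier (block_set P i) (block_bar P i) (nu i)
}.

Definition normalized_centers (R : realType) (m N : nat)
    (P : sep_problem R m N) (xc : forall i, 'cV[R]_(dims P i)) : Prop :=
  forall i,
    argmin (interior (block_set P i)) (block_bar P i) (xc i) /\
    block_bar P i (xc i) = 0.

Definition smoothed_lagr (R : realType) (m N : nat) (P : sep_problem R m N)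
    (y : 'cV[R]_m) (t : R) (x : sp_point P) : R :=
  total_obj P x + (y^T *m (coupling_mx P *m x - coupling_rhs P)) ord0 ord0 -
  t * total_bar P x.

Arguments smoothed_lagr {R m N} P y t x.

Definition dual_obj (R : realType) (m N : nat) (P : sep_problem R m N)
    (y : 'cV[R]_m) (t : R) : R :=
  sup (smoothed_lagr P y t @` interior (feas_set P)).

Definition xstar (R : realType) (m N : nat) (P : sep_problem R m N)
    (y : 'cV[R]_m) (t : R) : sp_point P :=
  xget 0 (argmax (interior (feas_set P)) (smoothed_lagr P y t)).

Definition grad_dual (R : realType) (m N : nat) (P : sep_problem R m N)
    (y : 'cV[R]_m) (t : R) : 'cV[R]_m :=
  grad (fun z => dual_obj P z t) y.

Definition dual_solutions (R : realType) (m N : nat) (P : sep_problem R m N)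
    (t : R) : set 'cV[R]_m :=
  argmin setT (fun y => dual_obj P y t).

Definition local_norm (R : realType) (m N : nat) (P : sep_problem R m N)
    (x : sp_point P) : R :=
  Num.sqrt (opnorm2
    (coupling_mx P *m invmx (hess (total_bar P) x) *m (coupling_mx P)^T)).

Arguments local_norm {R m N} P x.

Definition sc_omega (R : realType) (tau : R) : R := tau - ln (1 + tau).

(* [run_x 0] is the initialization point x^*(y^0; t_0); for every k,
   [run_x k.+1] is x_k^* = x^*(y^k; t_{k+1}).  With this shift, lambda_k, c_A^k
   and c_F^k are all attached to [run_x k].  When omega_k = c_F^k = 0 the
   quotient sigma_k is 0, so t_{k+1} = t_k. *)
Record pf_run (R : realType) (m N : nat) (P : sep_problem R m N) := PFRun {
  run_y : nat -> 'cV[R]_m;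
  run_t : nat -> R;
  run_lambda : nat -> R;
  run_x : nat -> sp_point P;
  run_cA : nat -> R;
  run_cF : nat -> R;
  run_omega : nat -> R;
  run_sigma : nat -> R;
  run_alpha : nat -> R;
  run_t0 : 0 < run_t 0%N;
  run_x0 : run_x 0%N = xstar P (run_y 0%N) (run_t 0%N);
  run_lambda0 :
    run_lambda 0%N = norm2 (grad_dual P (run_y 0%N) (run_t 0%N));
  run_cAE : forall k, run_cA k = local_norm P (run_x k);
  run_cFE : forall k, run_cF k = total_bar P (run_x k);
  run_omegaE : forall k, run_omega k = sc_omega (run_lambda k / run_cA k);
  run_sigmaE : forall k,
    run_sigma k = run_omega k / (2 * (run_omega k + run_cF k));
  run_tS : forall k, run_t k.+1 = run_t k * (1 - run_sigma k);
  run_xS : forall k, run_x k.+1 = xstar P (run_y k) (run_t k.+1);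
  run_lambdaS : forall k,
    run_lambda k.+1 = norm2 (grad_dual P (run_y k) (run_t k.+1));
  run_alphaS : forall k,
    run_alpha k.+1 =
      run_t k.+1 / (run_cA k.+1 * (run_cA k.+1 + run_lambda k.+1));
  run_yS : forall k,
    run_y k.+1 =
      run_y k - run_alpha k.+1 *: grad_dual P (run_y k) (run_t k.+1)
}.

(* Main.v *)
Require Import Defs.
From HB Require Import structures.
From mathcomp Require Import all_boot all_order all_algebra.
From mathcomp Require Import all_classical all_reals all_analysis.
From mathcomp Require Import ring lra.
Import Order.TTheory GRing.Theory Num.Theory numFieldNormedType.Exports.

Set Implicit Arguments.
Unset Strict Implicit.
Unset Printing Implicit Defensive.

Local Open Scope classical_set_scope.
Local Open Scope ring_scope.

(** Along the run, [t k] decreases to [tinf > 0], hence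
    [sigma k = 1 - t k.+1 / t k] tends to 0.  Since
    [omega = 2 sigma (omega + c_F)], this forces [omega k --> 0], hence
    [lambda k --> 0], as soon as [c_F] and [c_A] stay bounded.  [c_A] is bounded
    because the Dikin ellipsoids lie in the bounded set [X].  [c_F] is bounded
    when [y k] is: comparing [g (y; t)] with [g (y; tinf / 2)] bounds
    [F (xstar y t)] by [K (1 + |y|)].

    For the boundedness of [y k], the gradient step does not increase
    [g (.; t k.+1)], and shrinking [t] increases [g (y k; .)] by at most
    [(t k - t k.+1) F <= (t k - t k.+1) K (1 + |y k|)].  The unique minimizer
    makes [g (.; t 0) <= g (.; t k)] grow at least linearly, so [g (y k; t k)]
    satisfies a Gronwall recursion whose increments are summable, because
    [t k] converges.

    The step does not increase [g] because the gradient moves by at most its own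
    norm: self-concordance gives
    [<F'(x') - F'(x), x' - x> >= r^2 / (1 + r)] in the local norm [r] of
    [x' - x], which turns into a co-coercivity inequality for the dual gradient.
    Finally, the subgradient inequality passes to the limit along a subsequence
    of [y k]. *)

(** * Semicontinuity, compactness and Euclidean norms *)

(* Upper semicontinuity on [U], together with the value -oo on [K `\` U]. *)
Lemma usc_max (T : topologicalType) (R : realType) (K U : set T) (f : T -> R) :
  compact K -> U `<=` K -> U !=set0 ->
  (forall z c, K z -> (U z -> f z < c) -> \forall x \near z, U x -> f x < c) ->
  argmax U f !=set0.
Proof.
move=> cK UK [u0 Uu0] usc; apply: contrapT => noarg.
have ex_gt x : U x -> exists2 z, U z & f x < f z.
  move=> Ux; apply: contrapT => nz; apply: noarg; exists x; split=> // z Uz.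
  by rewrite leNgt; apply/negP => xz; apply: nz; exists z.
(* The superlevel sets [B w] generate a proper filter on [K]. At a cluster point [z], nearby points
   of [U] have values below some [f w], yet [B w] meets every neighbourhood of [z]. *)
pose B w := [set x | U x /\ f w <= f x].
have FF : ProperFilter (filter_from U B).
  apply: filter_from_proper => [|w Uw]; last by exists w.
  apply: filter_from_filter; first by exists u0.
  move=> v w Uv Uw; case: (leP (f v) (f w)) => vw.
    by exists w => // x [Ux wx]; split; split=> //; exact: le_trans wx.
  by exists v => // x [Ux vx]; split; split=> //; rewrite (le_trans (ltW vw)).
have FK : filter_from U B K by exists u0 => // x [/UK].
have [z [Kz clz]] := cK _ FF FK.
have [w Uw zw] : exists2 w, U w & U z -> f z < f w.
  case: (pselect (U z)) => [/ex_gt[w Uw zw]|nUz]; first by exists w.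
  by exists u0.
have [x [[Ux wx] /(_ Ux) xw]] := clz (B w) _ (ex_intro2 _ _ w Uw (fun x => id))
  (usc z (f w) Kz zw).
by move: (lt_le_trans xw wx); rewrite ltxx.
Qed.

Section matrix_norm.
Variables (R : realType) (m n : nat).
Implicit Types x : 'M[R]_(m, n).

Lemma mx_entry_le x i j : `|x i j| <= `|x|.
Proof.
rewrite [leRHS]/Num.norm /= mx_normrE; apply/bigmax_geP; right => /=.
by exists (i, j).
Qed.

Lemma mx_norm_leP x (M : R) : 0 <= M -> (forall i j, `|x i j| <= M) -> `|x| <= M.
Proof.
move=> M0 xM; rewrite [leLHS]/Num.norm /= mx_normrE; apply/bigmax_leP.
by split=> // -[i j] _; exact: xM.
Qed.

End matrix_norm.

Lemma dist_bound_continuous (R : realType) (V W : normedModType R)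
    (f : V -> W) (k : R) :
  (forall x y, `|f x - f y| <= k * `|x - y|) -> continuous f.
Proof.
move=> fk x; apply/(@cvgrPdist_lt _ _ _ (nbhs x)) => e e0.
have k0 : 0 < `|k| + 1 by rewrite ltr_wpDl.
near=> z; rewrite (le_lt_trans (fk _ _))//.
apply: (@le_lt_trans _ _ ((`|k| + 1) * `|x - z|)).
  by rewrite ler_wpM2r// (le_trans (ler_norm k))// lerDl.
rewrite -ltr_pdivlMl//; near: z; apply: (@cvgr_dist_lt _ _ _ (nbhs x) _ id) => //.
by rewrite mulr_gt0 ?invr_gt0.
Unshelve. all: by end_near. Qed.

Lemma mulmx_norm_le (R : realType) (m n : nat) (A : 'M[R]_(m, n)) (x : 'cV[R]_n) :
  `|A *m x| <= n%:R * `|A| * `|x|.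
Proof.
apply: mx_norm_leP => [|i j]; first by rewrite !mulr_ge0.
rewrite mxE (le_trans (ler_norm_sum _ _ _))//.
rewrite -mulrA mulr_natl -[X in _ *+ X]card_ord -sumr_const.
apply: ler_sum => k _; rewrite normrM.
by apply: ler_pM => //; exact: mx_entry_le.
Qed.

(** Transposition is a 1-Lipschitz involution, so the Heine-Borel property passes from row vectors
    to column vectors. *)
Lemma cV_compact (R : realType) (n : nat) (K : set 'cV[R]_n) :
  bounded_set K -> closed K -> compact K.
Proof.
move=> [M [Mr bK]] cK.
have trn (p q : nat) (x : 'M[R]_(p, q)) : `|x^T| <= `|x|.
  by apply: mx_norm_leP => // i j; rewrite mxE; exact: mx_entry_le.
have ctr (p q : nat) : continuous (fun x : 'M[R]_(p, q) => x^T).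
  apply: (@dist_bound_continuous _ _ _ _ 1) => x y.
  by rewrite -linearB mul1r trn.
have -> : K = trmx @` [set x : 'rV[R]_n | K x^T].
  apply/seteqP; split=> [x Kx|_ [x Kx <-]] //.
  by exists (trmx x) => //=; rewrite trmxK.
apply: continuous_compact; first exact/continuous_subspaceT/ctr.
apply: bounded_closed_compact.
  exists M; split=> // N MN x /= Kx; apply: (le_trans _ (bK N MN _ Kx)).
  by rewrite -{1}[x]trmxK trn.
by move/continuous_closedP: (@ctr 1%N n); exact.
Qed.

Definition dotp (R : realType) (n : nat) (u v : 'cV[R]_n) : R :=
  (u^T *m v) ord0 ord0.

Section dot_product.
Variables (R : realType) (n : nat).
Implicit Types u v w : 'cV[R]_n.

Lemma dotpE u v : dotp u v = \sum_i u i ord0 * v i ord0.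
Proof. by rewrite /dotp mxE; apply: eq_bigr => i _; rewrite mxE. Qed.

Lemma dotpDl u v w : dotp (u + v) w = dotp u w + dotp v w.
Proof. by rewrite /dotp linearD mulmxDl mxE. Qed.

Lemma dotpDr u v w : dotp u (v + w) = dotp u v + dotp u w.
Proof. by rewrite /dotp mulmxDr mxE. Qed.

Lemma dotpZl a u v : dotp (a *: u) v = a * dotp u v.
Proof. by rewrite /dotp linearZ -scalemxAl mxE. Qed.

Lemma dotpZr a u v : dotp u (a *: v) = a * dotp u v.
Proof. by rewrite /dotp -scalemxAr mxE. Qed.

Lemma dotpNl u v : dotp (- u) v = - dotp u v.
Proof. by rewrite -scaleN1r dotpZl mulN1r. Qed.

Lemma dotpNr u v : dotp u (- v) = - dotp u v.
Proof. by rewrite -scaleN1r dotpZr mulN1r. Qed.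

Lemma dotpC u v : dotp u v = dotp v u.
Proof. by rewrite !dotpE; apply: eq_bigr => i _; rewrite mulrC. Qed.

Lemma dotp_delta u i : dotp u (delta_mx i ord0) = u i ord0.
Proof.
rewrite dotpE (bigD1 i)//= big1 ?addr0 => [|j ji]; rewrite mxE ?eqxx ?mulr1//.
by rewrite (negbTE ji) mulr0.
Qed.

Lemma norm2_ge0 v : 0 <= norm2 v.
Proof. exact: sqrtr_ge0. Qed.

Lemma norm2_sqr v : norm2 v ^+ 2 = dotp v v.
Proof.
rewrite sqr_sqrtr; last by apply: sumr_ge0 => i _; exact: sqr_ge0.
by rewrite dotpE; apply: eq_bigr => i _; rewrite expr2.
Qed.

Lemma dotp_ge0 v : 0 <= dotp v v.
Proof. by rewrite -norm2_sqr sqr_ge0. Qed.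

Lemma mx_norm_le_norm2 v : `|v| <= norm2 v.
Proof.
apply: mx_norm_leP => [|i j]; first exact: norm2_ge0.
rewrite (ord1 j) -sqrtr_sqr ler_wsqrtr// (bigD1 i)//= lerDl.
by apply: sumr_ge0 => k _; exact: sqr_ge0.
Qed.

Lemma norm2_le_mx_norm v : norm2 v <= n%:R * `|v|.
Proof.
rewrite -[leRHS]ger0_norm ?mulr_ge0// -sqrtr_sqr ler_wsqrtr//.
apply: (@le_trans _ _ (\sum_(i < n) `|v| ^+ 2)).
  apply: ler_sum => i _; rewrite -[leLHS]ger0_norm ?sqr_ge0// normrX.
  by rewrite lerXn2r ?nnegrE//; exact: mx_entry_le.
rewrite sumr_const card_ord -[leLHS]mulr_natl exprMn.
apply: ler_wpM2r; first exact: sqr_ge0.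
by rewrite -natrX ler_nat; case: (n) => // k; exact: (@leq_pexp2l k.+1 1 2).
Qed.

Lemma norm2_eq0 v : norm2 v = 0 -> v = 0.
Proof.
by move=> v0; apply/eqP; rewrite -normr_le0 -v0; exact: mx_norm_le_norm2.
Qed.

Lemma norm2Z a v : norm2 (a *: v) = `|a| * norm2 v.
Proof.
apply/eqP; rewrite -(@eqrXn2 _ 2) ?mulr_ge0 ?norm2_ge0//.
by rewrite exprMn !norm2_sqr dotpZl dotpZr real_normK ?num_real//; apply/eqP; ring.
Qed.

End dot_product.

Lemma dotp_mulmxl (R : realType) (m n : nat) (A : 'M[R]_(m, n)) (u : 'cV_n)
    (v : 'cV_m) : dotp (A *m u) v = dotp u (A^T *m v).
Proof. by rewrite /dotp trmx_mul mulmxA. Qed.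

(** The form is nonnegative at [u + s *: v] for every [s], so this quadratic in [s] has nonpositive
    discriminant. When its leading coefficient [c] vanishes, a large [s] of suitable sign forces
    [b = 0]. *)
Lemma psd_Cauchy_Schwarz (R : realType) (n : nat) (H : 'M[R]_n) (u v : 'cV_n) :
  H^T = H -> (forall w, 0 <= dotp w (H *m w)) ->
  dotp u (H *m v) ^+ 2 <= dotp u (H *m u) * dotp v (H *m v).
Proof.
move=> symH psd.
set a := dotp u (H *m u); set b := dotp u (H *m v); set c := dotp v (H *m v).
have sym w z : dotp w (H *m z) = dotp z (H *m w).
  by rewrite dotpC dotp_mulmxl symH.
have quad s : 0 <= a + 2 * s * b + s ^+ 2 * c.
  have := psd (u + s *: v); rewrite mulmxDr -scalemxAr.
  rewrite !dotpDl !dotpDr !dotpZl !dotpZr (sym v u) -/a -/b -/c.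
  by congr (0 <= _); ring.
have a0 : 0 <= a := psd u.
have : 0 <= c := psd v.
rewrite le_eqVlt => /predU1P[c0|c0].
  rewrite -c0 mulr0 real_exprn_even_le0 ?num_real//=.
  apply: contraT => b0; have := quad (- (a + 1) / b).
  rewrite -c0 mulr0 addr0.
  have -> : a + 2 * (- (a + 1) / b) * b = - a - 2 by field.
  lra.
have := quad (- b / c).
have -> : a + 2 * (- b / c) * b + (- b / c) ^+ 2 * c = (a * c - b ^+ 2) / c.
  by field; rewrite gt_eqF.
by rewrite pmulr_lge0 ?invr_gt0// subr_ge0.
Qed.

Lemma Cauchy_Schwarz (R : realType) (n : nat) (u v : 'cV[R]_n) :
  `|dotp u v| <= norm2 u * norm2 v.
Proof.
rewrite -ler_sqr ?nnegrE ?mulr_ge0 ?norm2_ge0//.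
rewrite real_normK ?num_real// exprMn !norm2_sqr.
have := @psd_Cauchy_Schwarz R n 1%:M u v.
by rewrite !mul1mx trmx1; apply=> // w; rewrite mul1mx dotp_ge0.
Qed.

Lemma norm2_mulmx_le (R : realType) (m n : nat) (A : 'M[R]_(m, n)) (x : 'cV_n) :
  norm2 (A *m x) <= (m * n)%:R * `|A| * norm2 x.
Proof.
apply: le_trans (norm2_le_mx_norm _) _.
rewrite natrM -!mulrA ler_wpM2l// mulrA.
apply: le_trans (mulmx_norm_le _ _) _.
by rewrite ler_wpM2l ?mulr_ge0//; exact: mx_norm_le_norm2.
Qed.

(** * Directional derivatives of [Cn_on] functions *)

Lemma nbhs_plane (R : realType) (V : normedModType R) (x u v : V) (P : set V) :
  nbhs x P ->
  exists2 s : R, 0 < s &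
    forall a b, `|a| <= s -> `|b| <= s -> P (x + a *: u + b *: v).
Proof.
move=> /nbhs_ballP[e /= e0 xP].
have k0 : 0 < `|u| + `|v| + 1 by rewrite ltr_wpDl ?addr_ge0.
exists (e / (`|u| + `|v| + 1)); first by rewrite divr_gt0.
move=> a b ale ble; apply: xP; rewrite -ball_normE /ball_ /=.
rewrite -addrA opprD addNKr normrN (le_lt_trans (ler_normD _ _))// !normrZ.
apply: (@le_lt_trans _ _ (e / (`|u| + `|v| + 1) * (`|u| + `|v|))).
  by rewrite mulrDr lerD// ler_wpM2r.
by rewrite mulrAC ltr_pdivrMr// ltr_pM2l// ltrDl.
Qed.

Lemma continuous_near_dist (R : realType) (V : normedModType R) (f : V -> R)
    (x : V) (e : R) : {for x, continuous f} -> 0 < e ->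
  \forall z \near x, `|f x - f z| < e.
Proof. by move=> /cvgrPdist_lt cf /cf. Qed.

Lemma dist_add_le (R : realFieldType) (a b c p q e : R) :
  `|a - (p + q)| < e / 4 -> `|b - p| < e / 4 -> `|c - q| < e / 4 ->
  `|a - (b + c)| <= e.
Proof. by rewrite !ltr_norml ler_norml => *; apply/andP; split; lra. Qed.

Lemma dist_half_le (R : realFieldType) (a b p e : R) :
  `|a - p| < e / 2 -> `|b - p| < e / 2 -> `|a - b| <= e.
Proof. by rewrite !ltr_norml ler_norml => *; apply/andP; split; lra. Qed.

(** Mean value arguments give equal values of [f] and [g] at two different intermediate points;
    continuity at [x] is enough to conclude. *)
Lemma eq_near_values (R : realType) (V : normedModType R) (f g : V -> R) (x : V) :
  {for x, continuous f} -> {for x, continuous g} ->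
  (forall A, nbhs x A -> exists p q, [/\ A p, A q & f p = g q]) -> f x = g x.
Proof.
move=> cf cg ex; apply/eqP; rewrite -subr_eq0 -normr_le0.
apply/ler_addgt0Pl => e e0; rewrite addr0.
have e2 : 0 < e / 2 by rewrite divr_gt0.
have [p [q [[fp _] [_ gq] E]]] :=
  ex _ (filterI (continuous_near_dist cf e2) (continuous_near_dist cg e2)).
by move: fp; rewrite /= E => fp; exact: dist_half_le fp gq.
Qed.

Section directional.
Variables (R : realType) (V : normedModType R).
Implicit Types (f : V -> R) (x h u v : V) (s c : R).

Lemma is_derive_line f x h s : derivable f (x + s *: h) h ->
  is_derive s 1 (fun r : R => f (x + r *: h)) ('D_h f (x + s *: h)).
Proof.
move=> df.
have E : (fun r : R => r^-1 *: (f (x + (r *: 1 + s) *: h) - f (x + s *: h))) =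
    (fun r : R => r^-1 *: (f (r *: h + (x + s *: h)) - f (x + s *: h))).
  apply/funext => r; congr (_ *: (f _ - _)).
  by rewrite scalerDl addrCA; congr (_ *: _ + _); rewrite /GRing.scale/= mulr1.
by apply: DeriveDef; rewrite /derivable /derive /= ?E.
Qed.

(** Chain rule along the line, reparametrized by [r] to [c * r]; the case [c = 0] needs no separate
    treatment. *)
Lemma is_derive_dirZ f x h c : derivable f x h ->
  is_derive x (c *: h) f (c * 'D_h f x).
Proof.
move=> df.
have dl : is_derive (c * 0 : R) 1 (fun r : R => f (x + r *: h)) ('D_h f x).
  have x0 : x = x + (c * 0) *: h by rewrite mulr0 scale0r addr0.
  by rewrite [in 'D_h f x]x0; apply: is_derive_line; rewrite -x0.
have dc : is_derive (0 : R) 1 (fun r : R => c * r) c.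
  have -> : (fun r : R => c * r) = c \*: (@id R) by [].
  by apply: is_derive_eq; rewrite /GRing.scale/= mulr1.
have := is_derive1_comp dl dc.
have -> : (fun r : R => f (x + r *: h)) \o (fun r : R => c * r) =
    (fun r : R => f (r *: (c *: h) + x)).
  by apply/funext => r /=; rewrite scalerA addrC mulrC.
case=> d D; apply: DeriveDef; first exact/derivable1P.
rewrite mulrC -D /derive /=; apply: (congr1 (fun F : R -> R => lim (F @ (0 : R)^'))).
apply/funext => r.
by rewrite addr0 scale0r add0r /GRing.scale/= mulr1.
Qed.

Lemma derive_quotient_near f x v (e : R) : derivable f x v -> 0 < e ->
  \forall s \near (0 : R)^',
    `|'D_v f x - s^-1 * (f (x + s *: v) - f x)| < e.
Proof.
move=> df e0; have /cvgrPdist_lt/(_ _ e0) := df.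
by apply: filterS => s /=; rewrite [s *: v + x]addrC.
Qed.

End directional.

Section Cn_calculus.
Variables (R : realType) (d : nat).
Implicit Types (f g : 'cV[R]_d -> R) (U : set 'cV[R]_d) (x h u v : 'cV[R]_d).

Lemma Cn_on_continuous k U f x : Cn_on k U f -> U x -> {for x, continuous f}.
Proof. by case: k => [|k] [cf _] /cf. Qed.

Lemma Cn_on_derivable k U f x v : Cn_on k.+1 U f -> U x -> derivable f x v.
Proof. by move=> [_ /(_ v)[df _]] /df. Qed.

Lemma Cn_on_derive k U f v : Cn_on k.+1 U f -> Cn_on k U ('D_v f).
Proof. by move=> [_ /(_ v)[]]. Qed.

Lemma Cn_onW k U f : Cn_on k.+1 U f -> Cn_on k U f.
Proof.
elim: k f => [|k IH] f [cf Df]; split=> // v.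
by have [dv Dv] := Df v; split=> //; exact: IH.
Qed.

Lemma Cn_on_eq k U f g : open U -> (forall x, U x -> f x = g x) ->
  Cn_on k U f -> Cn_on k U g.
Proof.
move=> oU; elim: k f g => [|k IH] f g fg /= [cf Df];
  have nfg x : U x -> {near nbhs x, f =1 g} by
    (move=> Ux; apply: filterS (open_nbhs_nbhs (conj oU Ux)) => z; exact: fg).
  split=> // x Ux; rewrite /prop_for /continuous_at -fg//.
  by apply: cvg_trans (cf _ Ux); exact: (near_eq_cvg (nfg _ Ux)).
split=> [x Ux|v].
  rewrite /prop_for /continuous_at -fg//.
  by apply: cvg_trans (cf _ Ux); exact: (near_eq_cvg (nfg _ Ux)).
have [df Df'] := Df v; split=> [x Ux|].
  by apply: near_eq_derivable (df _ Ux); exact: nfg.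
by apply: IH Df' => x Ux; apply: near_eq_derive; exact: nfg.
Qed.

Lemma Cn_onD k U f g : open U -> Cn_on k U f -> Cn_on k U g ->
  Cn_on k U (fun x => f x + g x).
Proof.
move=> oU; elim: k f g => [|k IH] f g /= [cf Df] [cg Dg].
  by split=> // x Ux; apply: continuousD; [exact: cf|exact: cg].
split=> [x Ux|v]; first by apply: continuousD; [exact: cf|exact: cg].
have [df Df'] := Df v; have [dg Dg'] := Dg v; split=> [x Ux|].
  by apply: derivableD; [exact: df|exact: dg].
apply: Cn_on_eq (IH _ _ Df' Dg') => // x Ux.
by rewrite -deriveD//; [exact: df|exact: dg].
Qed.

Lemma Cn_on_cst k U (c : R) : open U -> Cn_on k U (fun=> c).
Proof.
move=> oU; elim: k c => [|k IH] c /=.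
  by split=> // x _; exact: cst_continuous.
split=> [x _|v]; first exact: cst_continuous.
split=> [x _|]; first exact: derivable_cst.
by apply: Cn_on_eq (IH 0) => // x _; rewrite derive_cst.
Qed.

Lemma Cn_on_sum k U n (f : 'I_n -> 'cV[R]_d -> R) : open U ->
  (forall i, Cn_on k U (f i)) -> Cn_on k U (fun x => \sum_i f i x).
Proof.
move=> oU Cf.
have -> : (fun x => \sum_i f i x) = \sum_i f i.
  by apply/funext => x; rewrite fct_sumE.
elim/big_ind : _ => [|f1 f2|i _]; [exact: Cn_on_cst|exact: Cn_onD|exact: Cf].
Qed.

Lemma is_derive_comp_linear n (l : 'cV[R]_d -> 'cV[R]_n) (f : 'cV[R]_n -> R) x v :
  (forall a x y, l (a *: x + y) = a *: l x + l y) ->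
  derivable f (l x) (l v) -> is_derive x v (f \o l) ('D_(l v) f (l x)).
Proof.
move=> lin df.
have E : (fun r : R => r^-1 *: (f (l (r *: v + x)) - f (l x))) =
    (fun r : R => r^-1 *: (f (r *: l v + l x) - f (l x))).
  by apply/funext => r; rewrite lin.
by apply: DeriveDef; rewrite /derivable /derive /= ?E.
Qed.

Lemma Cn_on_comp k n U (V : set 'cV[R]_n) (l : 'cV[R]_d -> 'cV[R]_n)
    (f : 'cV[R]_n -> R) :
  open U -> continuous l ->
  (forall a x y, l (a *: x + y) = a *: l x + l y) ->
  (forall x, U x -> V (l x)) ->
  Cn_on k V f -> Cn_on k U (f \o l).
Proof.
move=> oU cl lin UV; elim: k f => [|k IH] f /= [cf Df].
  by split=> // x /UV Vlx; apply: continuous_comp; [exact: cl|exact: cf].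
split=> [x /UV Vlx|v].
  by apply: continuous_comp; [exact: cl|exact: cf].
have [df Df'] := Df (l v); split=> [x /UV Vlx|].
  by have [] := @is_derive_comp_linear n l f x v lin (df _ Vlx).
apply: Cn_on_eq (IH _ Df') => // x /UV Vlx.
by have [_ ->] := @is_derive_comp_linear n l f x v lin (df _ Vlx).
Qed.

Lemma Cn_on_mvt U f x h : Cn_on 1 U f ->
  (forall s, 0 <= s <= 1 -> U (x + s *: h)) ->
  exists2 s : R, 0 <= s <= 1 & f (x + h) - f x = 'D_h f (x + s *: h).
Proof.
move=> Cf Ux.
have dphi (s : R) : 0 <= s <= 1 ->
    is_derive s 1 (fun r : R => f (x + r *: h)) ('D_h f (x + s *: h)).
  by move=> s01; apply: is_derive_line; apply: Cn_on_derivable Cf _; exact: Ux.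
have [s s01||s] := @MVT_segment R (fun r => f (x + r *: h))
    (fun r => 'D_h f (x + r *: h)) 0 1 ler01.
- by apply: dphi; move: s01; rewrite in_itv /= => /andP[/ltW -> /ltW ->].
- apply: derivable_within_continuous => s; rewrite in_itv/= => s01.
  by have [] := dphi s s01.
by rewrite in_itv/= subr0 mulr1 scale1r scale0r addr0 => s01 ->; exists s.
Qed.

(** [Cn_on] speaks of one direction at a time, so additivity has to be proved. The increment along
    [s *: (u + v)] is split into a leg along [u] and a leg along [v]; on the second leg the mean
    value theorem gives ['D_v f] at a point near [x], and continuity of ['D_v f] finishes. *)
Lemma Cn_on_deriveD U f x u v : open U -> Cn_on 1 U f -> U x ->
  'D_(u + v) f x = 'D_u f x + 'D_v f x.
Proof.
move=> oU Cf Ux; apply/eqP; rewrite -subr_eq0 -normr_le0.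
apply/ler_addgt0Pl => e e0; rewrite addr0.
have e4 : 0 < e / 4 by rewrite divr_gt0.
have [s0 s0_gt0 near_x] : exists2 s : R, 0 < s & forall a b, `|a| <= s ->
    `|b| <= s -> U (x + a *: u + b *: v) /\
      `|'D_v f x - 'D_v f (x + a *: u + b *: v)| < e / 4.
  apply: (@nbhs_plane _ _ x u v
    [set z | U z /\ `|'D_v f x - 'D_v f z| < e / 4]).
  have cD := continuous_near_dist (Cn_on_continuous (Cn_on_derive v Cf) Ux) e4.
  by apply: filterI cD; exact: open_nbhs_nbhs.
have df w : derivable f x w := Cn_on_derivable Cf Ux.
near (0 : R)^' => s.
have s_neq0 : s != 0 by near: s; exact: nbhs_dnbhs_neq.
have ss0 : `|s| <= s0 by near: s; exact: dnbhs0_le.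
have quv : `|'D_(u + v) f x - s^-1 * (f (x + s *: (u + v)) - f x)| < e / 4.
  by near: s; exact: derive_quotient_near.
have qu : `|'D_u f x - s^-1 * (f (x + s *: u) - f x)| < e / 4.
  by near: s; exact: derive_quotient_near.
have plane r : 0 <= r <= 1 -> `|r * s| <= s0.
  move=> /andP[r0 r1]; rewrite normrM (ger0_norm r0) (le_trans _ ss0)//.
  by rewrite ler_piMl.
have [r r01|r r01] := @Cn_on_mvt U f (x + s *: u) (s *: v) Cf.
  by rewrite scalerA; have [] := near_x s (r * s) ss0 (plane _ r01).
have [Up Dp] := near_x s (r * s) ss0 (plane _ r01).
rewrite scalerA.
have [_ ->] := is_derive_dirZ s (Cn_on_derivable (v := v) Cf Up).
move=> E; set w := 'D_v f (_ + _) in Dp E.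
have {}E : s^-1 * (f (x + s *: (u + v)) - f x) =
    s^-1 * (f (x + s *: u) - f x) + w.
  by rewrite scalerDr addrA -(subrK (f (x + s *: u)) (f (x + _ + _))) E; field.
by move: quv; rewrite E => quv; exact: dist_add_le quv qu Dp.
Unshelve. all: by end_near. Qed.

(** Two mean value theorems: in direction [u] for the difference of two parallel restrictions of
    [f], then in direction [v] for ['D_u f]. *)
Lemma second_difference U f x u v s : Cn_on 2 U f -> 0 < s ->
  (forall a b, `|a| <= s -> `|b| <= s -> U (x + a *: u + b *: v)) ->
  exists a b, [/\ `|a| <= s, `|b| <= s &
    f (x + s *: u + s *: v) - f (x + s *: u) - f (x + s *: v) + f x =
      s ^+ 2 * 'D_v ('D_u f) (x + a *: u + b *: v)].
Proof.
move=> Cf s0 Ux.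
have s0s : `|s| <= s by rewrite ger0_norm// ltW.
have in0s (r : R) : 0 <= r <= s -> `|r| <= s by move=> /andP[r0]; rewrite ger0_norm.
have Uxu (a : R) : 0 <= a <= s -> U (x + a *: u).
  move=> /in0s as0; have := Ux a 0 as0.
  by rewrite scale0r addr0 normr0; apply; exact: ltW.
have Uxv (a : R) : 0 <= a <= s -> U (x + s *: v + a *: u).
  by move=> /in0s as0; rewrite addrAC; exact: Ux.
have dphi (r : R) : 0 <= r <= s -> is_derive r 1
    ((fun a : R => f (x + s *: v + a *: u)) - (fun a : R => f (x + a *: u)))
    ('D_u f (x + s *: v + r *: u) - 'D_u f (x + r *: u)).
  move=> rs; apply: is_deriveB; apply: is_derive_line;
    apply: Cn_on_derivable Cf _; [exact: Uxv|exact: Uxu].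
have [r rs||r] := @MVT_segment R
    ((fun a : R => f (x + s *: v + a *: u)) - (fun a : R => f (x + a *: u)))
    (fun r => 'D_u f (x + s *: v + r *: u) - 'D_u f (x + r *: u)) 0 s (ltW s0).
- by apply: dphi; move: rs; rewrite in_itv /= => /andP[/ltW -> /ltW ->].
- apply: derivable_within_continuous => r; rewrite in_itv/= => rs.
  by have [] := dphi r rs.
rewrite in_itv/= => rs; have ars := in0s _ rs.
have plane b : 0 <= b <= 1 -> `|b * s| <= s.
  move=> /andP[b0 b1]; rewrite normrM (ger0_norm b0) (ger0_norm (ltW s0)).
  by rewrite ler_piMl// ltW.
have [b b01|b b01] := @Cn_on_mvt U ('D_u f) (x + r *: u) (s *: v) (Cn_on_derive u Cf).
  by rewrite scalerA; apply: Ux => //; exact: plane.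
have Up : U (x + r *: u + (b * s) *: v) by apply: Ux => //; exact: plane.
rewrite scalerA.
have [_ ->] := is_derive_dirZ s (Cn_on_derivable (v := v) (Cn_on_derive u Cf) Up).
rewrite [x + s *: v + _]addrAC => -> E.
exists r, (b * s); split=> //; first exact: plane.
move: E; rewrite /= -![(_ - _ : _ -> _) _]/(_ - _) scale0r !addr0 subr0 => E.
rewrite [x + s *: u + _]addrAC expr2 -mulrA [s * (s * _)]mulrC -E.
ring.
Qed.

(** The second difference is symmetric in [u] and [v], so the two mixed derivatives share a value at
    points arbitrarily close to [x]. *)
Lemma Cn_on_deriveC U f x u v : open U -> Cn_on 2 U f -> U x ->
  'D_u ('D_v f) x = 'D_v ('D_u f) x.
Proof.
move=> oU Cf Ux.
have cont w z : {for x, continuous ('D_w ('D_z f))}.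
  exact: Cn_on_continuous (Cn_on_derive w (Cn_on_derive z Cf)) Ux.
apply: (eq_near_values (cont u v) (cont v u)) => A xA.
have [s s0 near_x] := nbhs_plane u v (filterI xA (open_nbhs_nbhs (conj oU Ux))).
have [a b la lb|a [b [la lb E1]]] := @second_difference U f x u v s Cf s0.
  by have [] := near_x a b la lb.
have [c r lc lr|c [r [lc lr E2]]] := @second_difference U f x v u s Cf s0.
  by rewrite addrAC; have [] := near_x r c lr lc.
rewrite [x + c *: v + _]addrAC [x + s *: v + _]addrAC in E2.
exists (x + r *: u + c *: v), (x + a *: u + b *: v).
split; [exact: (near_x r c lr lc).1|exact: (near_x a b la lb).1|].
apply: (mulfI (x := s ^+ 2)); first by rewrite expf_neq0// gt_eqF.
apply: etrans (esym E2) (etrans _ E1).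
exact: (congr1 (fun z => z + f x) (addrAC _ _ _)).
Qed.

End Cn_calculus.

(** * Self-concordance *)

Section self_concordant_line.
Variables (R : realType) (w dw : R -> R) (b : R).
Hypothesis b_ge0 : 0 <= b.
Hypothesis w_derive : forall s, 0 <= s <= b -> is_derive s 1 w (dw s).
Hypothesis w_ge0 : forall s, 0 <= s <= b -> 0 <= w s.
Hypothesis w_sc : forall s, 0 <= s <= b -> `|dw s| <= 2 * (w s * Num.sqrt (w s)).

(* The shift by [e] makes [w + e] positive even where [w] vanishes, and the
   self-concordance inequality still bounds the derivative by 1. *)
Lemma inv_sqrt_lipschitz (e : R) : 0 < e ->
  `|(Num.sqrt (w b + e))^-1 - (Num.sqrt (w 0 + e))^-1| <= b.
Proof.
move=> e0.
pose q (s : R) := (Num.sqrt (w s + e))^-1.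
pose dq (s : R) := - (Num.sqrt (w s + e)) ^- 2 *:
  ((2 * Num.sqrt (w s + e))^-1 * dw s).
have We s : 0 <= s <= b -> 0 < w s + e by move=> /w_ge0 ws; rewrite ltr_wpDl.
have q_derive s : 0 <= s <= b -> is_derive s 1 q (dq s).
  move=> sb; apply: is_deriveV; first by rewrite gt_eqF// sqrtr_gt0 We.
  apply: (@is_derive1_comp R Num.sqrt (fun s => w s + e)).
    by apply: is_derive1_sqrt; exact: We.
  have -> : (fun s => w s + e) = w + cst e by [].
  by rewrite -[dw s]addr0; apply: is_deriveD; exact: w_derive.
have [s sb||s] := @MVT_segment R q dq 0 b b_ge0.
- by apply: q_derive; move: sb; rewrite in_itv/= => /andP[/ltW -> /ltW ->].
- apply: derivable_within_continuous => s; rewrite in_itv/= => sb.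
  by have [] := q_derive s sb.
rewrite in_itv/= subr0 -/(q b) -/(q 0) => sb ->.
rewrite normrM (ger0_norm b_ge0) ler_piMl// /dq.
have W0 := We s sb; set W := w s + e in W0 *.
have r0 : 0 < Num.sqrt W by rewrite sqrtr_gt0.
rewrite /GRing.scale/= normrM normrN normrM.
rewrite (gtr0_norm (x := _ ^- 2)) ?invr_gt0 ?exprn_gt0//.
rewrite (gtr0_norm (x := (2 * _)^-1)) ?invr_gt0 ?mulr_gt0//.
rewrite mulrA -invfM mulrC ler_pdivrMr ?mulr_gt0 ?exprn_gt0// mul1r.
apply: (le_trans (w_sc sb)).
rewrite [leRHS](_ : _ = 2 * (W * Num.sqrt W)); last first.
  by rewrite sqr_sqrtr ?(ltW W0)//; ring.
rewrite ler_pM2l//.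
have ws := w_ge0 sb.
by apply: ler_pM; rewrite ?sqrtr_ge0// ?ler_wsqrtr// lerDl ltW.
Qed.

(** The inverse square root of [w + e] loses at most [b] over a step of length [b], so it stays
    positive and bounds [w b] from above. *)
Lemma sc_curvature_le (e : R) : 0 < e -> b < (Num.sqrt (w 0 + e))^-1 ->
  w b <= ((Num.sqrt (w 0 + e))^-1 - b) ^- 2.
Proof.
move=> e0 ba; have := inv_sqrt_lipschitz e0.
set a := (Num.sqrt (w 0 + e))^-1 in ba *.
rewrite ler_norml => /andP[+ _]; rewrite lerBrDl => aq.
have wb : 0 <= w b by rewrite w_ge0// b_ge0 lexx.
have W0 : 0 < w b + e by rewrite ltr_wpDl.
have r0 : 0 < Num.sqrt (w b + e) by rewrite sqrtr_gt0.
apply: (@le_trans _ _ (w b + e)); first by rewrite lerDl ltW.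
rewrite -[leLHS]sqr_sqrtr ?(ltW W0)// -exprVn.
rewrite ler_sqr ?nnegrE ?invr_ge0 ?subr_ge0 ?(ltW r0) ?(ltW ba)//.
by rewrite -[leLHS]invrK lef_pV2 ?posrE ?invr_gt0 ?subr_gt0.
Qed.

End self_concordant_line.

(** The Lipschitz bound also gives [w s + e >= (r^-1 + s) ^- 2], where [r] is the square root of
    [w 0 + e]. Integrated over the unit interval, the right side is [r ^+ 2 / (1 + r)]; then [e]
    tends to 0. *)
Lemma sc_monotone (R : realType) (df w dw : R -> R) :
  (forall s : R, 0 <= s <= 1 -> is_derive s 1 df (w s)) ->
  (forall s : R, 0 <= s <= 1 -> is_derive s 1 w (dw s)) ->
  (forall s : R, 0 <= s <= 1 -> 0 <= w s) ->
  (forall s : R, 0 <= s <= 1 -> `|dw s| <= 2 * (w s * Num.sqrt (w s))) ->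
  w 0 / (1 + Num.sqrt (w 0)) <= df 1 - df 0.
Proof.
move=> df_derive w_derive w_ge0 w_sc; apply/ler_addgt0Pl => e e0.
have w00 : 0 <= w 0 by rewrite w_ge0// lexx ler01.
have W0 : 0 < w 0 + e by rewrite ltr_wpDl.
set r := Num.sqrt (w 0 + e).
have r0 : 0 < r by rewrite sqrtr_gt0.
have a0 : 0 < r^-1 by rewrite invr_gt0.
have le_s1 (s t : R) : 0 <= s <= 1 -> 0 <= t <= s -> 0 <= t <= 1.
  by move=> /andP[_ s1] /andP[-> ts]; exact: le_trans s1.
have w_low (s : R) : 0 <= s <= 1 -> (r^-1 + s) ^- 2 <= w s + e.
  move=> s01; have /andP[s0 s1] := s01.
  have ws : 0 < w s + e by rewrite ltr_wpDl// w_ge0.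
  have rs : 0 < Num.sqrt (w s + e) by rewrite sqrtr_gt0.
  have : `|(Num.sqrt (w s + e))^-1 - r^-1| <= s.
    by apply: (@inv_sqrt_lipschitz R w dw) => // t /(le_s1 s t s01) t01;
      [exact: w_derive|exact: w_ge0|exact: w_sc].
  rewrite ler_norml => /andP[_]; rewrite lerBlDr [s + _]addrC => q_le.
  rewrite -[leRHS]sqr_sqrtr ?(ltW ws)// -exprVn.
  rewrite ler_sqr ?nnegrE ?invr_ge0 ?(ltW rs) ?addr_ge0 ?(ltW a0)//.
  by rewrite -[leRHS]invrK lef_pV2 ?posrE ?invr_gt0// ltr_wpDr.
(* An antiderivative of the gap in [w_low]: its nonnegative derivative replaces the integration. *)
pose psi := df + (fun s => e * s) + (fun s => (r^-1 + s)^-1).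
pose dpsi (s : R) := w s + e - (r^-1 + s) ^- 2.
have psi_derive (s : R) : 0 <= s <= 1 -> is_derive s 1 psi (dpsi s).
  move=> s01; have /andP[s0 s1] := s01.
  apply: is_deriveD; first apply: is_deriveD.
  - exact: df_derive.
  - have -> : (fun s : R => e * s) = e \*: (@id R) by [].
    by apply: is_derive_eq; rewrite /GRing.scale/= mulr1.
  have -> : - (r^-1 + s) ^- 2 = - (r^-1 + s) ^- 2 *: (0 + 1 : R).
    by rewrite add0r /GRing.scale/= mulr1.
  have iD : is_derive s 1 (cst r^-1 + @id R) (0 + 1) by exact: is_deriveD.
  by apply: (is_deriveV _ iD); rewrite gt_eqF// ltr_wpDr.
have [s sb||s] := @MVT_segment R psi dpsi 0 1 ler01.
- by apply: psi_derive; move: sb; rewrite in_itv/= => /andP[/ltW -> /ltW ->].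
- apply: derivable_within_continuous => s; rewrite in_itv/= => sb.
  by have [] := psi_derive s sb.
rewrite in_itv/= subr0 mulr1 => s01 E.
have : 0 <= dpsi s by rewrite subr_ge0 w_low.
rewrite -E /psi -![(_ + _ : _ -> _) _]/(_ + _) mulr1 mulr0 !addr0 => psi_le.
have r1 : 1 + r != 0 by rewrite gt_eqF// addr_gt0.
have rn0 : r != 0 by rewrite gt_eqF.
have E2 : (r^-1 + 1)^-1 = r^-1^-1 - r ^+ 2 / (1 + r).
  have -> : r^-1 + 1 = (1 + r) / r by field.
  by rewrite invf_div invrK; field.
(* What remains is that [v ^+ 2 / (1 + v)] increases with [v], applied to [Num.sqrt (w 0) <= r]. *)
apply: (@le_trans _ _ (r ^+ 2 / (1 + r))); last by move: psi_le; rewrite E2; lra.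
have v0 : 0 <= Num.sqrt (w 0) by rewrite sqrtr_ge0.
have vr : Num.sqrt (w 0) <= r by rewrite ler_wsqrtr// lerDl ltW.
rewrite -[X in X / _]sqr_sqrtr//; set v := Num.sqrt (w 0) in v0 vr *.
rewrite ler_pdivrMr ?ltr_wpDr// mulrAC ler_pdivlMr ?addr_gt0//.
rewrite !mulrDr !mulr1 lerD//; first by rewrite ler_sqr ?nnegrE ?(ltW r0).
rewrite (_ : v ^+ 2 * r = v * r * v); last by ring.
rewrite (_ : r ^+ 2 * v = v * r * r); last by ring.
by rewrite ler_wpM2l// mulr_ge0// ltW.
Qed.

Lemma convex_set_comb (R : realType) (E : lmodType R) (X : set E) (x y : E)
    (s : R) : convex_set X -> X x -> X y -> 0 <= s <= 1 ->
  X (s *: x + (1 - s) *: y).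
Proof.
move=> cX Xx Xy /andP[s0 s1].
by have := cX x y (Itv01 s0 s1) (mem_set Xx) (mem_set Xy); rewrite inE.
Qed.

Lemma convex_function_comb (R : realType) (E : lmodType R) (X : set E)
    (f : E -> R) (x y : E) (s : R) :
  convex_function X f -> X x -> X y -> 0 <= s <= 1 ->
  f (s *: x + (1 - s) *: y) <= s * f x + (1 - s) * f y.
Proof.
move=> cf Xx Xy /andP[s0 s1].
exact: (cf (Itv01 s0 s1) x y (mem_set Xx) (mem_set Xy)).
Qed.

(** The homothety with centre [y] and ratio [1 - s] maps a ball around [x] inside [X] onto a ball
    around the given point, and convexity keeps it in [X]. *)
Lemma interior_segment (R : realType) (V : normedModType R) (X : set V) (x y : V)
    (s : R) : convex_set X -> interior X x -> interior X y -> 0 <= s <= 1 ->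
  interior X (x + s *: (y - x)).
Proof.
move=> cX ix iy /andP[s0 s1].
have [->|sn1] := eqVneq s 1; first by rewrite scale1r addrC subrK.
have s_lt1 : 0 < 1 - s by rewrite subr_gt0 lt_neqAle sn1.
have /nbhs_ballP[e /= e0 xX] := ix.
apply/nbhs_ballP; exists ((1 - s) * e); first exact: mulr_gt0.
move=> z; rewrite -ball_normE /ball_ /= => zx.
have Xx' : X (x + (1 - s)^-1 *: (z - (x + s *: (y - x)))).
  apply: xX; rewrite -ball_normE /ball_ /= opprD addNKr normrN normrZ.
  by rewrite gtr0_norm ?invr_gt0// distrC ltr_pdivrMl.
have := convex_set_comb cX (interior_subset iy) Xx' _.
move=> /(_ s); rewrite s0 s1 => /(_ isT); congr (X _).
rewrite scalerDr scalerA divff ?gt_eqF// scale1r.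
have -> : x + s *: (y - x) = s *: y + (1 - s) *: x.
  by rewrite scalerBr scalerBl scale1r addrCA.
by rewrite addrA addrC subrK.
Qed.

Section directional_bilinear.
Variables (R : realType) (d : nat).
Implicit Types (f : 'cV[R]_d -> R) (U : set 'cV[R]_d) (x h u v : 'cV[R]_d).

Lemma Cn_on_derive_sum U f x h : open U -> Cn_on 1 U f -> U x ->
  'D_h f x = \sum_i h i ord0 * 'D_(delta_mx i ord0) f x.
Proof.
move=> oU Cf Ux; rewrite [in LHS](matrix_sum_delta h).
under eq_bigr do rewrite big_ord1.
rewrite (big_morph (fun v => 'D_v f x) (op1 := +%R) (id1 := 0)) ?derive0//.
  apply: eq_bigr => i _.
  exact: (@derive_val _ _ _ _ _ _ _ (is_derive_dirZ (h i ord0) (Cn_on_derivable Cf Ux))).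
by move=> u v /=; rewrite (Cn_on_deriveD u v oU Cf Ux).
Qed.

Lemma hess_sym U f x : open U -> Cn_on 2 U f -> U x -> (hess f x)^T = hess f x.
Proof.
move=> oU Cf Ux; apply/matrixP => i j; rewrite !mxE.
exact: Cn_on_deriveC Cf Ux.
Qed.

Lemma hess_quadratic U f x h : open U -> Cn_on 2 U f -> U x ->
  dotp h (hess f x *m h) = 'D_h ('D_h f) x.
Proof.
move=> oU Cf Ux; rewrite (Cn_on_derive_sum _ oU (Cn_on_derive h Cf) Ux) dotpE.
apply: eq_bigr => i _; congr (_ * _); rewrite (Cn_on_deriveC _ _ oU Cf Ux).
rewrite (Cn_on_derive_sum _ oU (Cn_on_derive _ Cf) Ux) mxE.
have hessE j : hess f x i j =
    'D_(delta_mx j ord0) ('D_(delta_mx i ord0) f) x.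
  by rewrite mxE; exact: (Cn_on_deriveC _ _ oU Cf Ux).
by apply: eq_bigr => j _; rewrite hessE [LHS]mulrC.
Qed.

End directional_bilinear.

(** * Coercive symmetric matrices and the operator norm of [A *m invmx H *m A^T] *)

Section local_norm_matrix.
Variables (R : realType) (m n : nat) (H : 'M[R]_n) (A : 'M[R]_(m, n)) (k : R).
Hypothesis k_ge0 : 0 <= k.
Hypothesis H_sym : H^T = H.
Hypothesis H_coercive : forall h, norm2 h ^+ 2 <= k * dotp h (H *m h).

Lemma coercive_psd h : 0 <= dotp h (H *m h).
Proof.
(* If [k = 0], coercivity leaves only the zero vector. *)
have := H_coercive h; have := k_ge0; rewrite le_eqVlt => /predU1P[<-|k0].
  rewrite mul0r => h0; suff -> : h = 0.
    by rewrite mulmx0 dotpE big1// => i; rewrite !mxE mul0r.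
  by apply: norm2_eq0; apply/eqP; rewrite -sqrf_eq0 eq_le h0 sqr_ge0.
by move=> h0; rewrite -(pmulr_rge0 _ k0) (le_trans (sqr_ge0 _) h0).
Qed.

Lemma coercive_unitmx : H \in unitmx.
Proof.
rewrite -row_free_unit -kermx_eq0; apply/eqP/row_matrixP => i; rewrite row0.
apply: trmx_inj; rewrite trmx0; apply: norm2_eq0; apply/eqP.
rewrite -sqrf_eq0 eq_le sqr_ge0 andbT (le_trans (H_coercive _))//.
have -> : H *m (row i (kermx H))^T = 0.
  by rewrite -[X in X *m _]H_sym -trmx_mul -row_mul mulmx_ker row0 trmx0.
by rewrite dotpE big1 ?mulr0// => j _; rewrite !mxE mulr0.
Qed.

(** With [h = invmx H *m w], coercivity and Cauchy-Schwarz give [norm2 h ^+ 2 <= k * dotp h w <= k *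
    (norm2 h * norm2 w)]. *)
Lemma norm2_invmx_le w : norm2 (invmx H *m w) <= k * norm2 w.
Proof.
set h := invmx H *m w.
have Hh : H *m h = w by rewrite mulmxA mulmxV ?coercive_unitmx// mul1mx.
have := H_coercive h; rewrite Hh => hk.
have [h0|h_neq0] := eqVneq (norm2 h) 0; first by rewrite h0 mulr_ge0 ?norm2_ge0.
have h_gt0 : 0 < norm2 h by rewrite lt_neqAle eq_sym h_neq0 norm2_ge0.
rewrite -(ler_pM2l h_gt0) -expr2 (le_trans hk)// mulrCA ler_wpM2l//.
exact: le_trans (ler_norm _) (Cauchy_Schwarz _ _).
Qed.

Let M := A *m invmx H *m A^T.

Lemma opnorm2_has_sup (p q : nat) (B : 'M[R]_(p, q)) :
  has_sup [set norm2 (B *m v) | v in [set v | norm2 v <= 1]].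
Proof.
split.
  exists (norm2 (B *m 0)), 0 => //=.
  by rewrite -(scale0r (0 : 'cV[R]_q)) norm2Z normr0 mul0r.
exists ((p * q)%:R * `|B|) => _ [v /= v1 <-].
by rewrite (le_trans (norm2_mulmx_le _ _))// ler_piMr// mulr_ge0.
Qed.

Lemma norm2_mulmx_opnorm (p q : nat) (B : 'M[R]_(p, q)) v :
  norm2 (B *m v) <= opnorm2 B * norm2 v.
Proof.
have [v0|v_neq0] := eqVneq (norm2 v) 0.
  by rewrite v0 mulr0 (norm2_eq0 v0) mulmx0 -(scale0r 0) norm2Z normr0 mul0r.
have v_gt0 : 0 < norm2 v by rewrite lt_neqAle eq_sym v_neq0 norm2_ge0.
rewrite -ler_pdivrMr// mulrC.
have -> : (norm2 v)^-1 * norm2 (B *m v) = norm2 (B *m ((norm2 v)^-1 *: v)).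
  by rewrite -scalemxAr norm2Z gtr0_norm ?invr_gt0.
apply: sup_ubound; first exact: (opnorm2_has_sup B).2.
exists ((norm2 v)^-1 *: v) => //=.
by rewrite norm2Z gtr0_norm ?invr_gt0// mulVf.
Qed.

Lemma opnorm2_le (p q : nat) (B : 'M[R]_(p, q)) (c : R) : 0 <= c ->
  (forall v, norm2 (B *m v) <= c * norm2 v) -> opnorm2 B <= c.
Proof.
move=> c0 Bc; apply: ge_sup; first exact: (opnorm2_has_sup B).1.
by move=> _ [v /= v1 <-]; rewrite (le_trans (Bc v))// ler_piMr.
Qed.

Lemma opnorm2_ge0 (p q : nat) (B : 'M[R]_(p, q)) : 0 <= opnorm2 B.
Proof.
have zero : norm2 (0 : 'cV[R]_q) = 0.
  by rewrite -(scale0r (0 : 'cV[R]_q)) norm2Z normr0 mul0r.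
apply: le_trans (norm2_ge0 (B *m 0)) _.
apply: sup_ubound; first exact: (opnorm2_has_sup B).2.
by exists 0 => //=; rewrite zero.
Qed.

(** Put [v = A *m h] and [w = invmx H *m (A^T *m v)]. Then [norm2 v ^+ 2 = dotp h (H *m w)], to
    which Cauchy-Schwarz for [H] applies, and [dotp w (H *m w) = dotp v (M *m v)] is at most
    [opnorm2 M * norm2 v ^+ 2]. *)
Lemma norm2_mulmx_local h :
  norm2 (A *m h) <= Num.sqrt (opnorm2 M) * Num.sqrt (dotp h (H *m h)).
Proof.
set v := A *m h; set w := invmx H *m (A^T *m v).
have Hw : H *m w = A^T *m v by rewrite mulmxA mulmxV ?coercive_unitmx// mul1mx.
have vv : norm2 v ^+ 2 = dotp h (H *m w).
  by rewrite norm2_sqr {1}/v dotp_mulmxl Hw.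
have ww : dotp w (H *m w) <= opnorm2 M * norm2 v ^+ 2.
  rewrite Hw dotpC dotp_mulmxl trmxK /w !mulmxA -/M expr2 mulrCA.
  apply: le_trans (ler_norm _) (le_trans (Cauchy_Schwarz _ _) _).
  by rewrite -mulmxA -/v ler_wpM2l ?norm2_ge0// norm2_mulmx_opnorm.
have CS := psd_Cauchy_Schwarz h w H_sym coercive_psd.
rewrite -sqrtrM ?opnorm2_ge0//.
have [v0|v_neq0] := eqVneq (norm2 v) 0; first by rewrite v0 sqrtr_ge0.
have v2 : 0 < norm2 v ^+ 2 by rewrite exprn_even_gt0.
rewrite -[leLHS]ger0_norm ?norm2_ge0// -sqrtr_sqr ler_wsqrtr//.
rewrite -(ler_pM2r v2) -expr2 {1}vv (le_trans CS)//.
by rewrite [leRHS]mulrAC mulrC ler_wpM2r ?coercive_psd.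
Qed.

Lemma opnorm2_local_le :
  opnorm2 M <= (m * n)%:R * `|A| * (k * ((n * m)%:R * `|A^T|)).
Proof.
apply: opnorm2_le => [|v]; first by rewrite !mulr_ge0.
rewrite /M -!mulmxA (le_trans (norm2_mulmx_le _ _))// -[leRHS]mulrA.
rewrite ler_wpM2l ?mulr_ge0// (le_trans (norm2_invmx_le _))// -mulrA.
by rewrite ler_wpM2l// norm2_mulmx_le.
Qed.

End local_norm_matrix.

(** The properties that the blocks pass on to the total barrier, in the form used along lines:
    convexity as a sign of the second derivative, the power 3/2 as a product with a square root,
    blow-up as a neighbourhood statement. *)
Record bounded_barrier (R : realType) (d : nat) (X : set 'cV[R]_d)
    (F : 'cV[R]_d -> R) : Prop := BoundedBarrier {
  bb_closed : closed X;
  bb_convex : convex_set X;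
  bb_bounded : exists M : R, forall x, X x -> `|x| <= M;
  bb_C3 : Cn_on 3 (interior X) F;
  bb_convexF : forall x h, interior X x -> 0 <= 'D_h ('D_h F) x;
  bb_sc : forall x h, interior X x ->
    `|'D_h ('D_h ('D_h F)) x| <=
      2 * ('D_h ('D_h F) x * Num.sqrt ('D_h ('D_h F) x));
  bb_blowup : forall z (c : R), (X `\` interior X) z ->
    \forall x \near z, interior X x -> c < F x
}.

Lemma inv_sqr_subr_le (R : realFieldType) (a r s : R) : r <= s -> s < a ->
  (a - r) ^- 2 <= (a - s) ^- 2.
Proof.
move=> rs sa; have ra := le_lt_trans rs sa.
rewrite lef_pV2 ?posrE ?exprn_gt0 ?subr_gt0//.
by rewrite ler_sqr ?nnegrE ?subr_ge0 ?(ltW sa) ?(ltW ra)// lerB.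
Qed.

(** * Barriers along lines and the Dikin ellipsoid *)

Section barrier.
Variables (R : realType) (d : nat) (X : set 'cV[R]_d) (F : 'cV[R]_d -> R).
Hypothesis bF : bounded_barrier X F.
Let U := interior X.
Implicit Types x h : 'cV[R]_d.

Let oU : open U. Proof. exact: open_interior. Qed.

Lemma barrier_line_derive x h (s : R) : U (x + s *: h) ->
  [/\ is_derive s 1 (fun r : R => F (x + r *: h)) ('D_h F (x + s *: h)),
      is_derive s 1 (fun r : R => 'D_h F (x + r *: h))
        ('D_h ('D_h F) (x + s *: h)) &
      is_derive s 1 (fun r : R => 'D_h ('D_h F) (x + r *: h))
        ('D_h ('D_h ('D_h F)) (x + s *: h))].
Proof.
move=> Us; have C3 := bb_C3 bF.
split; apply: is_derive_line.
- exact: (Cn_on_derivable C3).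
- exact: (Cn_on_derivable (Cn_on_derive h C3)).
- exact: (Cn_on_derivable (Cn_on_derive h (Cn_on_derive h C3))).
Qed.

Lemma line_MVT_le (f df : R -> R) (b B : R) : 0 <= b ->
  (forall s : R, 0 <= s <= b -> is_derive s 1 f (df s)) ->
  (forall s : R, 0 <= s <= b -> df s <= B) -> f b <= f 0 + B * b.
Proof.
move=> b0 f_derive dfB.
have [s sb||s] := @MVT_segment R f df 0 b b0.
- by apply: f_derive; move: sb; rewrite in_itv/= => /andP[/ltW -> /ltW ->].
- apply: derivable_within_continuous => s; rewrite in_itv/= => sb.
  by have [] := f_derive s sb.
by rewrite in_itv/= subr0 -lerBlDl => sb ->; rewrite ler_wpM2r// dfB.
Qed.

Lemma barrier_line_bounded x h (a e s : R) : U x -> 0 < e ->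
  a = (Num.sqrt ('D_h ('D_h F) x + e))^-1 -> 0 <= s -> s < a ->
  exists C, forall b, 0 <= b <= s ->
    (forall r, 0 <= r <= b -> U (x + r *: h)) -> F (x + b *: h) <= C.
Proof.
move=> Ux e0 aE s0 sa.
set B := (a - s) ^- 2; set S := 'D_h F x + B * s.
exists (F x + `|S| * s) => b /andP[b0 bs] Ur.
have B0 : 0 <= B by rewrite invr_ge0 exprn_ge0// subr_ge0 ltW.
have wB r : 0 <= r <= b -> 'D_h ('D_h F) (x + r *: h) <= B.
  move=> /andP[r0 rb].
  have rbW t : 0 <= t <= r -> 0 <= t <= b.
    by move=> /andP[-> tr]; exact: le_trans rb.
  have x0 : 'D_h ('D_h F) (x + 0 *: h) = 'D_h ('D_h F) x.
    by rewrite scale0r addr0.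
  have rs : r <= s := le_trans rb bs.
  apply: le_trans (inv_sqr_subr_le rs sa); rewrite aE -x0.
  apply: (@sc_curvature_le R (fun t => 'D_h ('D_h F) (x + t *: h))
    (fun t => 'D_h ('D_h ('D_h F)) (x + t *: h)) r r0 _ _ _ e e0).
  - by move=> t /rbW /Ur /barrier_line_derive[].
  - by move=> t /rbW /Ur Ut; exact: (bb_convexF bF).
  - by move=> t /rbW /Ur Ut; exact: (bb_sc bF).
  - by rewrite x0 -aE; exact: le_lt_trans sa.
have dS r : 0 <= r <= b -> 'D_h F (x + r *: h) <= `|S|.
  move=> /andP[r0 rb].
  have rbW t : 0 <= t <= r -> 0 <= t <= b.
    by move=> /andP[-> tr]; exact: le_trans rb.
  have dr : 'D_h F (x + r *: h) <= 'D_h F (x + 0 *: h) + B * r.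
    apply: (@line_MVT_le (fun t => 'D_h F (x + t *: h))
      (fun t => 'D_h ('D_h F) (x + t *: h)) r B r0).
      by move=> t /rbW /Ur /barrier_line_derive[].
    by move=> t /rbW tb; exact: wB.
  rewrite scale0r addr0 in dr; apply: (le_trans dr).
  apply: le_trans (ler_norm S); rewrite lerD2l ler_wpM2l//.
  exact: le_trans bs.
have Fb : F (x + b *: h) <= F (x + 0 *: h) + `|S| * b.
  apply: (@line_MVT_le (fun t => F (x + t *: h)) (fun t => 'D_h F (x + t *: h))
    b `|S| b0 _ dS).
  by move=> t /Ur /barrier_line_derive[].
rewrite scale0r addr0 in Fb; apply: (le_trans Fb).
by rewrite lerD2l ler_wpM2l.
Qed.

(* The Dikin ellipsoid lies in the domain: along a line, [F] stays bounded as
   long as the step is below the inverse of the local norm, so the barrier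
   cannot blow up before. *)
Lemma Dikin_line x h (e s : R) : U x -> 0 < e ->
  0 <= s -> s < (Num.sqrt ('D_h ('D_h F) x + e))^-1 -> U (x + s *: h).
Proof.
set a := (Num.sqrt _)^-1 => Ux e0 s0 sa; apply: contrapT; rewrite /not => nUs.
(* The infimum [t] of [E] is the first exit step. The point at [t] is outside [U] because [U] is
   open, and in [X] because [X] is closed, so [F] must blow up there, against
   [barrier_line_bounded]. *)
pose E : set R := [set r | 0 <= r <= s /\ (U (x + r *: h) -> False)].
have E_inf : has_inf E.
  split; first by exists s; split; rewrite ?s0 ?lexx.
  by exists 0 => r [/andP[]].
set t := inf E.
have t0 : 0 <= t by apply: lb_le_inf; [exact: E_inf.1|move=> r [/andP[]]].
have ts : t <= s by apply: ge_inf; [exact: E_inf.2|split; rewrite ?s0 ?lexx].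
have Ult r : 0 <= r -> r < t -> U (x + r *: h).
  move=> r0 rt; apply: contrapT; rewrite /not => nUr.
  suff : t <= r by rewrite leNgt rt.
  apply: ge_inf; first exact: E_inf.2.
  by split=> //; rewrite r0 (ltW (lt_le_trans rt ts)).
have step (P : set 'cV[R]_d) : nbhs (x + t *: h) P ->
    exists2 r : R, 0 < r & forall q, `|q| <= r -> P (x + (t + q) *: h).
  move=> /(nbhs_plane h 0)[r r0 Pr]; exists r => // q qr.
  have := Pr q 0 qr; rewrite normr0 (ltW r0) scale0r addr0 => /(_ isT).
  by rewrite -addrA -scalerDl.
have nUt : U (x + t *: h) -> False.
  move=> Ut; have [r r0 Ur] := step U (open_nbhs_nbhs (conj oU Ut)).
  have [q [/andP[q0 qs] nUq]] := inf_adherent r0 E_inf; rewrite -/t => qtr.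
  have tq : t <= q.
    by apply: ge_inf; [exact: E_inf.2|split; [rewrite q0 qs|exact: nUq]].
  apply: nUq; rewrite -(subrKC t q); apply: Ur.
  have -> : `|q - t| = q - t by apply: ger0_norm; rewrite subr_ge0.
  rewrite lerBlDl; exact: ltW.
have t_gt0 : 0 < t.
  rewrite lt_neqAle t0 andbT; apply/negP => /eqP t0'.
  by apply: nUt; rewrite -t0' scale0r addr0.
have back r : 0 < r -> exists2 q, 0 <= q < t & `|q - t| <= r.
  move=> r0; exists (t - Num.min r t).
    by rewrite subr_ge0 ge_min lexx orbT/= gtrBl lt_min r0.
  by rewrite addrAC subrr sub0r normrN ger0_norm ?ge_min ?lexx// le_min t0 ltW.
have Xt : X (x + t *: h).
  apply: contrapT; rewrite /not => nXt.
  have [r r0 Xr] := step (~` X) (open_nbhs_nbhs (conj (closed_openC (bb_closed bF)) nXt)).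
  have [q /andP[q0 qt] qr] := back r r0.
  by apply: (Xr _ qr); rewrite subrKC; apply: interior_subset; exact: Ult.
have [C FC] := @barrier_line_bounded x h a e t Ux e0 erefl t0 (le_lt_trans ts sa).
have [r r0 Fr] := step _ (bb_blowup bF C (conj Xt nUt)).
have [q /andP[q0 qt] qr] := back r r0.
have Uq : U (x + q *: h) by exact: Ult.
have := Fr _ qr; rewrite subrKC => /(_ Uq); apply/negP; rewrite -leNgt.
apply: FC; first by rewrite q0 ltW.
move=> p /andP[p0 pq]; exact: (Ult p p0 (le_lt_trans pq qt)).
Qed.

(** Half a Dikin step along [h] stays in [X], where norms are at most [M]; so the step has norm at
    most [2 * M], that is, [h] has norm at most [4 * M] times the square root of [w + e], and [e]
    tends to 0. The factor [d%:R ^+ 2] converts the sup norm to the Euclidean one. *)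
Lemma Dikin_coercive : exists2 k : R, 0 <= k &
  forall x, U x -> forall h, norm2 h ^+ 2 <= k * 'D_h ('D_h F) x.
Proof.
have [M XM] := bb_bounded bF.
exists (d%:R ^+ 2 * (4 * `|M|) ^+ 2); first by rewrite mulr_ge0 ?sqr_ge0.
move=> x Ux h.
apply: (@le_trans _ _ (d%:R ^+ 2 * `|h| ^+ 2)).
  rewrite -exprMn ler_sqr ?nnegrE ?norm2_ge0 ?mulr_ge0//.
  exact: norm2_le_mx_norm.
rewrite -[leRHS]mulrA; apply: ler_wpM2l; first exact: sqr_ge0.
have w0 := bb_convexF bF h Ux.
set w := 'D_h ('D_h F) x in w0 *; set K := (4 * `|M|) ^+ 2.
have K0 : 0 <= K by exact: sqr_ge0.
have hK e : 0 < e -> `|h| ^+ 2 <= K * (w + e).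
  move=> e0; have W0 : 0 < w + e by rewrite ltr_wpDl.
  have r0 : 0 < Num.sqrt (w + e) by rewrite sqrtr_gt0.
  have Us : U (x + ((Num.sqrt (w + e))^-1 / 2) *: h).
    apply: (Dikin_line Ux e0); first by rewrite divr_ge0// invr_ge0 ltW.
    by rewrite ltr_pdivrMr// ltr_pMr ?invr_gt0// ltr1n.
  have hle : (Num.sqrt (w + e))^-1 / 2 * `|h| <= 2 * `|M|.
    rewrite -[X in X * _]ger0_norm ?divr_ge0 ?invr_ge0 ?(ltW r0)// -normrZ.
    rewrite -[X in `|X|](addKr x) (le_trans (ler_normD _ _))// normrN mulr_natl.
    by rewrite mulr2n lerD// (le_trans (XM _ (interior_subset _)))// ler_norm.
  rewrite -[w + e]sqr_sqrtr ?(ltW W0)// -exprMn ler_sqr ?nnegrE ?mulr_ge0 ?(ltW r0)//.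
  move: hle; rewrite mulrAC ler_pdivrMr// ler_pdivrMl// => hle.
  by rewrite (le_trans hle)// le_eqVlt; apply/orP; left; apply/eqP; ring.
apply/ler_addgt0Pl => e e0.
have K1 : 0 < K + 1 by rewrite ltr_wpDl.
apply: le_trans (hK (e / (K + 1)) _) _; first by rewrite divr_gt0.
rewrite mulrDr addrC lerD2r mulrA ler_pdivrMr// mulrC ler_pM2l// lerDl.
exact: ler01.
Qed.

Lemma barrier_monotone x z : U x -> U z ->
  'D_(z - x) ('D_(z - x) F) x / (1 + Num.sqrt ('D_(z - x) ('D_(z - x) F) x)) <=
  'D_(z - x) F z - 'D_(z - x) F x.
Proof.
move=> Ux Uz; set h := z - x.
have Us s : 0 <= s <= 1 -> U (x + s *: h).
  by move=> s01; apply: interior_segment => //; exact: (bb_convex bF).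
have zE : z = x + 1 *: h by rewrite scale1r subrKC.
have xE : x = x + 0 *: h by rewrite scale0r addr0.
rewrite zE [in 'D_h F x]xE [in 'D_h ('D_h F) x]xE.
apply: (@sc_monotone R (fun r => 'D_h F (x + r *: h))
  (fun r => 'D_h ('D_h F) (x + r *: h))
  (fun r => 'D_h ('D_h ('D_h F)) (x + r *: h))).
- by move=> s /Us /barrier_line_derive[].
- by move=> s /Us /barrier_line_derive[].
- by move=> s /Us Us'; exact: (bb_convexF bF).
- by move=> s /Us Us'; exact: (bb_sc bF).
Qed.

End barrier.

(** * Separable problems *)

Section block_decomposition.
Variables (R : realType) (N : nat) (p : 'I_N -> nat).
Notation point := 'cV[R]_(\sum_i p i).
Notation blk x i := (submxcol (p_ := p) x i).
Implicit Types x z h : point.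

Lemma submxcol_linear (i : 'I_N) (a : R) x z :
  blk (a *: x + z) i = a *: blk x i + blk z i.
Proof. by apply/matrixP => j k; rewrite !mxE. Qed.

Lemma submxcol_norm_le x i : `|blk x i| <= `|x|.
Proof. by apply: mx_norm_leP => // j k; rewrite mxE; exact: mx_entry_le. Qed.

Lemma norm_le_submxcol x (M : R) : 0 <= M -> (forall i, `|blk x i| <= M) ->
  `|x| <= M.
Proof.
move=> M0 xM; apply: mx_norm_leP => // k j.
rewrite -(tagnat.sig2K k); have := mx_entry_le (blk x (tagnat.sig1 k)) (tagnat.sig2 k) j.
by rewrite mxE => /le_trans; apply.
Qed.

Lemma submxcol_continuous i : continuous (fun x => blk x i).
Proof.
apply: (@dist_bound_continuous _ _ _ _ 1) => x z.
by rewrite -submxcolB mul1r submxcol_norm_le.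
Qed.

Variable X : forall i, set 'cV[R]_(p i).
Let XX : set point := [set x | forall i, X (blk x i)].

Lemma interior_blocks x : interior XX x <-> forall i, interior (X (i := i)) (blk x i).
Proof.
split=> [/nbhs_ballP[e /= e0 xX] i|ix].
  apply/nbhs_ballP; exists e => //= v; rewrite -ball_normE /ball_ /= => vx.
  (* The point [z] is [x] with its block [i] replaced by [v]; it is as close to [x] as [v] is to
     that block. *)
  pose c := @dfwith 'I_N (fun j => 'cV[R]_(p j)) (fun j => blk x j) i v.
  pose z : point := \mxcol_j c j.
  have zE j : blk z j = c j by exact: mxcolK.
  have : XX z.
    apply: xX; rewrite -ball_normE /ball_ /=.
    apply: le_lt_trans vx; apply: norm_le_submxcol => // j.
    rewrite submxcolB zE /c; case: dfwithP => [//|k ik].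
    by rewrite subrr normr0.
  have ci : c i = v by exact: dfwith_in.
  by move=> /(_ i); rewrite zE ci.
have : \forall z \near x, forall i, i \in enum 'I_N -> X (blk z i).
  elim: (enum 'I_N) => [|i s IH]; first by near=> z.
  have Xi := @submxcol_continuous i x _ (ix i).
  near=> z => j; rewrite inE => /predU1P[->|js].
    by near: z; exact: Xi.
  by move: j js; near: z; exact: IH.
by apply: filterS => z Xz i; apply: Xz; rewrite mem_enum.
Unshelve. all: by end_near. Qed.

(** The decomposition of [Gt] is required on [U] only, so the lemma can be applied again to the
    derivatives it produces, up to order three. *)
Lemma derive_blocks (V : forall i, set 'cV[R]_(p i))
    (G : forall i, 'cV[R]_(p i) -> R) (Gt : point -> R) (U : set point) x h :
  open U -> (forall z i, U z -> V i (blk z i)) ->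
  (forall i, Cn_on 1 (V i) (G i)) ->
  (forall z, U z -> Gt z = \sum_i G i (blk z i)) -> U x ->
  'D_h Gt x = \sum_i 'D_(blk h i) (G i) (blk x i).
Proof.
move=> oU UV CG GtE Ux.
pose g i : point -> R := G i \o (fun z => blk z i).
have dg i : is_derive x h (g i) ('D_(blk h i) (G i) (blk x i)).
  apply: (@is_derive_comp_linear _ _ _ (fun z => blk z i) (G i) x h).
    exact: submxcol_linear.
  exact: (Cn_on_derivable (CG i) (UV _ i Ux)).
have gE : {near nbhs x, Gt =1 \sum_i g i}.
  apply: filterS (open_nbhs_nbhs (conj oU Ux)) => z Uz.
  by rewrite GtE// fct_sumE.
rewrite (near_eq_derive h gE) derive_sum => [|i]; last by have [] := dg i.
by apply: eq_bigr => i _; have [] := dg i.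
Qed.

End block_decomposition.

Lemma powR_3half (R : realType) (a : R) : 0 <= a ->
  a `^ (3 / 2) = a * Num.sqrt a.
Proof.
rewrite le_eqVlt => /predU1P[<-|a0].
  by rewrite mul0r powR0// mulf_neq0// invr_eq0.
have -> : 3 / 2 = 1 + 2^-1 :> R by field.
by rewrite powRD ?gt_eqF// ?implybT// powRr1 ?ltW// powR12_sqrt// ltW.
Qed.

(* Replacing [h] by [c *: h] in the parameter inequality makes it quadratic in
   [c] and bounded above. *)
Lemma scb_convexF (R : realType) (d : nat) (X : set 'cV[R]_d) (F : 'cV[R]_d -> R)
    (nu : R) (x h : 'cV[R]_d) :
  self_concordant_barrier X F nu -> 0 < nu -> interior X x ->
  0 <= 'D_h ('D_h F) x.
Proof.
move=> bF nu0 Ux; have C3 := scb_C3 bF.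
have C2 := Cn_onW C3.
have oU := @open_interior _ X.
have D1 c : 'D_(c *: h) F x = c * 'D_h F x.
  exact: (@derive_val _ _ _ _ _ _ _ (is_derive_dirZ c (Cn_on_derivable C3 Ux))).
have D2 c : 'D_(c *: h) ('D_(c *: h) F) x = c ^+ 2 * 'D_h ('D_h F) x.
  have [_ ->] := is_derive_dirZ c
    (Cn_on_derivable (v := h) (Cn_on_derive (c *: h) C3) Ux).
  rewrite (Cn_on_deriveC _ _ oU C2 Ux).
  have [_ ->] := is_derive_dirZ c
    (Cn_on_derivable (v := h) (Cn_on_derive h C3) Ux).
  by rewrite mulrA -expr2.
have param c : 2 * (c * 'D_h F x) - c ^+ 2 * 'D_h ('D_h F) x <= nu.
  by rewrite -D1 -D2; exact: (scb_param bF).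
move: param; move: ('D_h F x) ('D_h ('D_h F) x) => D W param.
rewrite leNgt; apply/negP => W0.
(* Adding the parameter inequalities for [c] and [- c] gives [c ^+ 2 * - W <= nu]. By this choice
   [nu = (c - 1) * - W], hence [c ^+ 2 <= c - 1], impossible for [c > 1]. *)
pose c := nu / - W + 1.
have cW : (c - 1) * - W = nu by rewrite /c addrK divfK// oppr_eq0 lt_eqF.
have c1 : 1 < c by rewrite ltrDr divr_gt0// oppr_gt0.
have p1 := param c; have := param (- c); rewrite sqrrN => p2.
have : c ^+ 2 * - W <= nu by lra.
rewrite -cW ler_pM2r ?oppr_gt0//; nra.
Qed.

Section problem.
Variables (R : realType) (m N : nat) (P : sep_problem R m N) (nu : 'I_N -> R)
  (xc : forall i, 'cV[R]_(dims P i)).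
Hypotheses (hP : problem_data P) (hA1 : assumption_A1 P)
  (hA2 : assumption_A2 P nu) (hxc : normalized_centers xc).
Local Notation X := (feas_set P).
Local Notation U := (interior (feas_set P)).
Implicit Types (x z h : 'cV[R]_(\sum_i dims P i)) (y : 'cV[R]_m) (s t c : R).

Lemma feas_interiorP x :
  U x <-> forall i, interior (block_set P i) (submxcol x i).
Proof. exact: interior_blocks. Qed.

Lemma feas_closed : closed X.
Proof.
have -> : X = \bigcap_i ((fun x => submxcol x i) @^-1` block_set P i).
  by apply/seteqP; split=> x Xx i => [_|]; exact: Xx.
apply: closed_bigI => i _.
have /continuous_closedP ctc := @submxcol_continuous R N (dims P) i.
exact: ctc _ (@pd_closed _ _ _ _ hP i).
Qed.

Lemma feas_convex : convex_set X.
Proof.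
move=> x z l /[!inE] Xx Xz i.
have := pd_convex hP l (mem_set (Xx i)) (mem_set (Xz i)).
rewrite inE; congr (block_set P i _).
by apply/matrixP => j k; rewrite !mxE.
Qed.

Lemma feas_bounded : exists M : R, forall x, X x -> `|x| <= M.
Proof.
have bX i : exists M : R, 0 <= M /\ forall v, block_set P i v -> `|v| <= M.
  have [M [Mr bM]] := A2_bounded hA2 i; exists (`|M| + 1); split=> // v Xv.
  by apply: bM => //; rewrite (le_lt_trans (ler_norm M))// ltrDl.
have [M MX] := choice bX.
exists (\sum_i M i) => x Xx; apply: norm_le_submxcol.
  by apply: sumr_ge0 => i _; case: (MX i).
move=> i; apply: le_trans ((MX i).2 _ (Xx i)) _.
by rewrite (bigD1 i)//= lerDl sumr_ge0// => j _; case: (MX j).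
Qed.

Lemma feas_compact : compact X.
Proof.
apply: cV_compact feas_closed; have [M XM] := feas_bounded.
exists M; split; first exact: num_real.
by move=> K /ltW MK x Xx; exact: le_trans (XM _ Xx) MK.
Qed.

Lemma feas_interior_nonempty : U !=set0.
Proof.
exists (\mxcol_i xc i); apply/feas_interiorP => i.
by rewrite mxcolK; case: (hxc i) => -[].
Qed.

Lemma block_bar_ge0 i v : interior (block_set P i) v -> 0 <= block_bar P i v.
Proof. by have [[_ minF] <-] := hxc i => /minF. Qed.

Lemma total_bar_ge0 x : U x -> 0 <= total_bar P x.
Proof.
move=> /feas_interiorP Ux; apply: sumr_ge0 => i _.
exact: block_bar_ge0.
Qed.

Let bar i := A2_barrier hA2 i.

Lemma total_bar_derive1 x h : U x -> 'D_h (total_bar P) x =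
  \sum_i 'D_(submxcol h i) (block_bar P i) (submxcol x i).
Proof.
apply: (derive_blocks (V := fun i => interior (block_set P i))) => //.
- exact: open_interior.
- by move=> z i /feas_interiorP.
- by move=> i; exact: Cn_onW (Cn_onW (scb_C3 (bar i))).
Qed.

Lemma total_bar_derive2 x h : U x -> 'D_h ('D_h (total_bar P)) x =
  \sum_i 'D_(submxcol h i) ('D_(submxcol h i) (block_bar P i)) (submxcol x i).
Proof.
apply: (derive_blocks (V := fun i => interior (block_set P i))
  (G := fun i => 'D_(submxcol h i) (block_bar P i))).
- exact: open_interior.
- by move=> z i /feas_interiorP.
- by move=> i; exact: Cn_onW (Cn_on_derive _ (scb_C3 (bar i))).
- by move=> z Uz; exact: total_bar_derive1.
Qed.

Lemma total_bar_derive3 x h : U x -> 'D_h ('D_h ('D_h (total_bar P))) x =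
  \sum_i 'D_(submxcol h i) ('D_(submxcol h i) ('D_(submxcol h i)
    (block_bar P i))) (submxcol x i).
Proof.
apply: (derive_blocks (V := fun i => interior (block_set P i))
  (G := fun i => 'D_(submxcol h i) ('D_(submxcol h i) (block_bar P i)))).
- exact: open_interior.
- by move=> z i /feas_interiorP.
- by move=> i; exact: Cn_on_derive _ (Cn_on_derive _ (scb_C3 (bar i))).
- by move=> z Uz; exact: total_bar_derive2.
Qed.

(** Self-concordance is additive because each block curvature is at most the total one. Blow-up
    survives summation because the normalization at the centers makes every block barrier
    nonnegative. *)
Lemma total_bar_barrier : bounded_barrier X (total_bar P).
Proof.
have block_ge0 x h i : U x -> 0 <=
    'D_(submxcol h i) ('D_(submxcol h i) (block_bar P i)) (submxcol x i).
  by move=> /feas_interiorP Ux; exact: scb_convexF (bar i) (A2_nu hA2 i) (Ux i).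
split.
- exact: feas_closed.
- exact: feas_convex.
- exact: feas_bounded.
- have -> : total_bar P = fun x => \sum_i
      ((block_bar P i \o (fun x => submxcol x i)) x) by [].
  apply: Cn_on_sum => [|i]; first exact: open_interior.
  apply: (Cn_on_comp _ (@submxcol_continuous _ _ _ i) _ _ (scb_C3 (bar i))).
  + exact: open_interior.
  + exact: submxcol_linear.
  + by move=> x /feas_interiorP.
- by move=> x h Ux; rewrite total_bar_derive2// sumr_ge0// => i _; exact: block_ge0.
- move=> x h Ux; rewrite total_bar_derive3// total_bar_derive2//.
  apply: le_trans (ler_norm_sum _ _ _) _; rewrite mulr_suml mulr_sumr.
  apply: ler_sum => i _; have /feas_interiorP/(_ i) Uxi := Ux.
  apply: le_trans (scb_sc (bar i) _ Uxi) _.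
  rewrite powR_3half ?block_ge0// ler_wpM2l// ler_wpM2l ?block_ge0//.
  by rewrite ler_wsqrtr// (bigD1 i)//= lerDl sumr_ge0// => j _; exact: block_ge0.
- move=> z c [Xz nUz].
  (* A point of [X] outside its interior has a block outside the interior of its own set; that block
     alone drives the sum to infinity. *)
  have [i nUi] : exists i, ~ interior (block_set P i) (submxcol z i).
    by apply/existsNP => Uz; apply: nUz; apply/feas_interiorP.
  have cF : nbhs (submxcol z i) [set v | interior (block_set P i) v ->
      c < block_bar P i v].
    have /cvgryPgt/(_ c) := scb_blowup (bar i) (conj (Xz i) nUi).
    by rewrite near_withinE.
  have near_cF := @submxcol_continuous _ _ _ i z _ cF.
  apply: (@filterS _ (nbhs z) _ _ _ _ near_cF) => x /= {}cF /feas_interiorP Ux.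
  apply: lt_le_trans (cF (Ux i)) _.
  by rewrite /total_bar (bigD1 i)//= lerDl sumr_ge0// => j _; exact: block_bar_ge0.
Qed.

Lemma total_obj_concave x z s : 0 <= s <= 1 ->
  total_obj P x + s * (total_obj P z - total_obj P x) <=
  total_obj P (x + s *: (z - x)).
Proof.
move=> s01; rewrite /total_obj -sumrB mulr_sumr -big_split/=.
apply: ler_sum => i _.
have := convex_function_comb (x := submxcol z i) (y := submxcol x i)
  (@A1_concave _ _ _ _ hA1 i) I I s01.
have -> : s *: submxcol z i + (1 - s) *: submxcol x i =
    submxcol (x + s *: (z - x)) i.
  apply/matrixP => j k; rewrite !mxE; ring.
lra.
Qed.

Lemma total_obj_usc z c : total_obj P z < c ->
  \forall x \near z, total_obj P x < c.
Proof.
move=> zc.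
(* Dividing by [N + 1] keeps the [N] slacks together strictly below the gap. *)
pose e := (c - total_obj P z) / (N%:R + 1).
have N1 : 0 < N%:R + 1 :> R by rewrite ltr_wpDl.
have e0 : 0 < e by rewrite divr_gt0// subr_gt0.
have near_blk i : \forall x \near z,
    block_obj P i (submxcol x i) < block_obj P i (submxcol z i) + e.
  have [|V zV Vlt] := @A1_usc _ _ _ _ hA1 i
    (submxcol z i) (- (block_obj P i (submxcol z i) + e)).
    by rewrite lte_fin ltrN2 ltrDl.
  have near_V := @submxcol_continuous _ _ _ i z _ zV.
  apply: (@filterS _ (nbhs z) _ _ _ _ near_V) => x /Vlt.
  by rewrite lte_fin ltrN2.
have : \forall x \near z, forall i, i \in enum 'I_N ->
    block_obj P i (submxcol x i) < block_obj P i (submxcol z i) + e.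
  elim: (enum 'I_N) => [|i l IH]; first by near=> x.
  near=> x => j; rewrite inE => /predU1P[->|jl].
    by near: x; exact: near_blk.
  by move: j jl; near: x; exact: IH.
apply: filterS => x xlt.
apply: (@le_lt_trans _ _ (total_obj P z + N%:R * e)).
  rewrite /total_obj -[X in X%:R * _]card_ord mulr_natl -sumr_const -big_split/=.
  by apply: ler_sum => i _; rewrite ltW// xlt// mem_enum.
rewrite -ltrBrDl /e mulrCA gtr_pMr ?subr_gt0//.
by rewrite ltr_pdivrMr// mul1r ltrDl.
Unshelve. all: by end_near. Qed.

End problem.

(** * The smoothed dual function *)

(** This is [d ^+ 2 / (c * (c + d)) <= r ^+ 2 / (1 + r)] without denominators: the right side
    increases with [r], and at [r = d / c] it equals the left side. *)
Lemma sc_step_bound (R : realFieldType) (c d r : R) :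
  0 <= c -> 0 <= d -> 0 <= r -> d <= c * r ->
  d ^+ 2 * (1 + r) <= r ^+ 2 * (c * (c + d)).
Proof.
move=> c0 d0 r0 dcr.
have cr0 : 0 <= c * r by rewrite mulr_ge0.
have -> : r ^+ 2 * (c * (c + d)) = (c * r) ^+ 2 + d * (c * r) * r by ring.
rewrite mulrDr mulr1 lerD//; first by rewrite ler_sqr ?nnegrE.
by rewrite ler_wpM2r// expr2 ler_wpM2l.
Qed.

Lemma add_opposite_gaps (R : realFieldType) (o o' p q u v : R) :
  o' - o + p <= u -> o - o' - q <= - v -> v - u <= q - p.
Proof. lra. Qed.

Section dual.
Variables (R : realType) (m N : nat) (P : sep_problem R m N) (nu : 'I_N -> R)
  (xc : forall i, 'cV[R]_(dims P i)).
Hypotheses (hP : problem_data P) (hA1 : assumption_A1 P)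
  (hA2 : assumption_A2 P nu) (hxc : normalized_centers xc).
Local Notation X := (feas_set P).
Local Notation U := (interior (feas_set P)).
Local Notation A := (coupling_mx P).
Local Notation L := (smoothed_lagr P).
Local Notation F := (total_bar P).
Local Notation g := (dual_obj P).
Implicit Types (x : 'cV[R]_(\sum_i dims P i)) (y z : 'cV[R]_m) (s t c : R).

Let barF := total_bar_barrier hP hA2 hxc.

Definition resid x := A *m x - coupling_rhs P.

Lemma smoothed_lagrE y t x :
  L y t x = total_obj P x + dotp y (resid x) - t * F x.
Proof. by []. Qed.

Lemma residB x x' : resid x - resid x' = A *m (x - x').
Proof. by rewrite /resid opprB addrA subrK -mulmxBr. Qed.

Lemma resid_bounded : exists2 B : R, 0 <= B & forall x, X x -> `|resid x| <= B.
Proof.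
have [M XM] := feas_bounded hA2.
exists ((\sum_i dims P i)%:R * `|A| * `|M| + `|coupling_rhs P|).
  by rewrite addr_ge0// !mulr_ge0.
move=> x Xx; apply: le_trans (ler_normB _ _) _; rewrite lerD2r.
apply: le_trans (mulmx_norm_le _ _) _; rewrite ler_wpM2l ?mulr_ge0//.
exact: le_trans (XM x Xx) (ler_norm M).
Qed.

Lemma dotp_resid_continuous y : continuous (fun x => dotp y (resid x)).
Proof.
apply: (@dist_bound_continuous _ _ _ _
  (norm2 y * (m%:R * ((\sum_i dims P i)%:R * `|A|)))) => u v.
rewrite -dotpNr -dotpDr residB; apply: le_trans (Cauchy_Schwarz _ _) _.
rewrite -!mulrA ler_wpM2l ?norm2_ge0//.
apply: le_trans (norm2_le_mx_norm _) _; rewrite ler_wpM2l// mulrA.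
exact: mulmx_norm_le.
Qed.

(** Inside [U] the Lagrangian is an upper semicontinuous objective plus continuous terms; at the
    remaining points of the compact set [X] the term [- t * F] drives it to -oo. *)
Lemma smoothed_lagr_argmax y t : 0 < t -> argmax U (L y t) !=set0.
Proof.
move=> t0; apply: (@usc_max _ _ X).
- exact: feas_compact hP hA2.
- exact: interior_subset.
- exact: feas_interior_nonempty hxc.
move=> z c Xz Lz.
have [Uz|nUz] := pselect (U z).
  pose e := (c - L y t z) / 3.
  have e0 : 0 < e by rewrite divr_gt0// subr_gt0 Lz.
  have et0 : 0 < e / t by rewrite divr_gt0.
  have n1 : \forall x \near z, total_obj P x < total_obj P z + e.
    by apply: (total_obj_usc hA1); rewrite ltrDl.
  have n2 := continuous_near_dist (@dotp_resid_continuous y z) e0.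
  have n3 := continuous_near_dist (Cn_on_continuous (bb_C3 barF) Uz) et0.
  apply: (@filterS _ (nbhs z) _ _ _ _ (filterI n1 (filterI n2 n3))).
  move=> x [/= x1 [x2 x3]] Ux; rewrite smoothed_lagrE.
  have x3' : t * F z - t * F x < e.
    by rewrite -mulrBr -ltr_pdivlMl// mulrC (le_lt_trans (ler_norm _)).
  move: x2; rewrite ltr_norml => /andP[x2 _].
  have : c = L y t z + e *+ 3.
    by rewrite /e -mulr_natr divfK ?pnatr_eq0// subrKC.
  rewrite smoothed_lagrE; move: x1 x2 x3' e0.
  move: (total_obj P x) (total_obj P z) (dotp y (resid x)) (dotp y (resid z))
    (t * F x) (t * F z) => a1 a2 a3 a4 a5 a6 *.
  lra.
(* Near [z] the first two terms exceed their values at [z] by less than 1 each; once [F] is above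
   [C], the Lagrangian is below [c]. *)
pose C := (total_obj P z + 1 + dotp y (resid z) + 1 - c) / t.
have n1 : \forall x \near z, total_obj P x < total_obj P z + 1.
  by apply: (total_obj_usc hA1); rewrite ltrDl.
have n2 := continuous_near_dist (@dotp_resid_continuous y z) (@ltr01 R).
have n3 := bb_blowup barF C (conj Xz nUz).
apply: (@filterS _ (nbhs z) _ _ _ _ (filterI n1 (filterI n2 n3))).
move=> x [/= x1 [x2 x3]] Ux; rewrite smoothed_lagrE.
have := x3 Ux; rewrite /C ltr_pdivrMr// mulrC => {}x3.
move: x2; rewrite ltr_norml => /andP[x2 _].
move: x1 x2 x3.
move: (total_obj P x) (total_obj P z) (dotp y (resid x)) (dotp y (resid z))
  (t * F x) => a1 a2 a3 a4 a5 *.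
lra.
Qed.

Lemma xstar_argmax y t : 0 < t -> argmax U (L y t) (xstar P y t).
Proof. by move=> t0; apply: xgetPex; exact: smoothed_lagr_argmax. Qed.

Lemma xstar_interior y t : 0 < t -> U (xstar P y t).
Proof. by move=> /(xstar_argmax y)[]. Qed.

Lemma dual_objE y t : 0 < t -> g y t = L y t (xstar P y t).
Proof.
move=> t0; have [Ux maxx] := xstar_argmax y t0.
apply/eqP; rewrite eq_le; apply/andP; split.
  apply: ge_sup => [|_ [x Ux' <-]]; last exact: maxx.
  by exists (L y t (xstar P y t)), (xstar P y t).
apply: sup_ubound; last by exists (xstar P y t).
by exists (L y t (xstar P y t)) => _ [x Ux' <-]; exact: maxx.
Qed.

Lemma smoothed_lagr_le_dual y t x : 0 < t -> U x -> L y t x <= g y t.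
Proof. by move=> t0 Ux; rewrite dual_objE//; exact: (xstar_argmax y t0).2. Qed.

(** The maximizer for [y] is a candidate for [z], and the Lagrangian is affine in the multiplier. *)
Lemma dual_subgradient y z t : 0 < t ->
  g y t + dotp (z - y) (resid (xstar P y t)) <= g z t.
Proof.
move=> t0; apply: le_trans (smoothed_lagr_le_dual z t0 (xstar_interior y t0)).
rewrite dual_objE// !smoothed_lagrE dotpDl dotpNl.
by rewrite le_eqVlt; apply/orP; left; apply/eqP; ring.
Qed.

Lemma dual_antitone y t t' : 0 < t -> t <= t' -> g y t' <= g y t.
Proof.
move=> t0 tt'; have t'0 := lt_le_trans t0 tt'.
have Ux := xstar_interior y t'0.
apply: le_trans (smoothed_lagr_le_dual y t0 Ux).
rewrite dual_objE// !smoothed_lagrE lerD2l lerN2 ler_wpM2r//.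
exact: (total_bar_ge0 hxc).
Qed.

(** A first-order condition without derivatives of the objective: for a small step [s] towards [x],
    concavity bounds the gain of the objective below by [s] times its full difference, while the
    barrier changes by [s * 'D_h F] up to an error [e * s]. *)
Lemma xstar_optimality y t x : 0 < t -> U x ->
  total_obj P x - total_obj P (xstar P y t) +
    dotp y (A *m (x - xstar P y t)) <=
  t * 'D_(x - xstar P y t) F (xstar P y t).
Proof.
move=> t0 Ux; set x0 := xstar P y t; set h := x - x0.
have Ux0 : U x0 := xstar_interior y t0.
set k := _ + dotp _ _; rewrite -ler_pdivrMl//.
apply/ler_addgt0Pl => e e0.
have dF : derivable F x0 h := Cn_on_derivable (bb_C3 barF) Ux0.
have [r /= r0 near_r] := derive_quotient_near dF e0.
(* The bound [r / 2] makes the difference quotient accurate; the bound 1 keeps the point on the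
   segment. *)
pose s := Num.min (r / 2) 1.
have s0 : 0 < s by rewrite lt_min divr_gt0//=.
have s1 : s <= 1 by rewrite ge_min lexx orbT.
have sr : ball (0 : R) r s.
  rewrite /ball/= sub0r normrN gtr0_norm// (@le_lt_trans _ _ (r / 2))//.
    by rewrite ge_min lexx.
  by rewrite ltr_pdivrMr// ltr_pMr// ltr1n.
have := near_r s sr (lt0r_neq0 s0); rewrite ltr_norml => /andP[De _].
have s01 : 0 <= s <= 1 by rewrite ltW.
have Us : U (x0 + s *: h) := interior_segment (bb_convex barF) Ux0 Ux s01.
have := (xstar_argmax y t0).2 _ Us; rewrite !smoothed_lagrE -/x0.
have -> : resid (x0 + s *: h) = resid x0 + s *: (A *m h).
  by rewrite /resid mulmxDr -scalemxAr addrAC.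
rewrite dotpDr dotpZr => Lle.
have conc := total_obj_concave hA1 x0 x s01.
have kF : s * k <= t * (F (x0 + s *: h) - F x0).
  by move: Lle conc; rewrite /k -/h; lra.
have kF' : t^-1 * k <= s^-1 * (F (x0 + s *: h) - F x0).
  by rewrite ler_pdivrMl// mulrCA ler_pdivlMl.
lra.
Qed.

Lemma local_norm_ge0 x : 0 <= local_norm P x.
Proof. exact: sqrtr_ge0. Qed.

Lemma hess_coercive : exists2 k : R, 0 <= k & forall x, U x ->
  (hess F x)^T = hess F x /\
  forall h, norm2 h ^+ 2 <= k * dotp h (hess F x *m h).
Proof.
have [k k0 kD] := Dikin_coercive barF; exists k => // x Ux.
have oU := @open_interior _ X; have C2 := Cn_onW (bb_C3 barF).
split=> [|h]; first exact: hess_sym oU C2 Ux.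
by rewrite (hess_quadratic h oU C2 Ux); exact: kD.
Qed.

Lemma norm2_mulmx_le_local x h : U x ->
  norm2 (A *m h) <= local_norm P x * Num.sqrt ('D_h ('D_h F) x).
Proof.
move=> Ux; have [k k0 /(_ x Ux)[Hsym Hk]] := hess_coercive.
rewrite -(hess_quadratic h (@open_interior _ X) (Cn_onW (bb_C3 barF)) Ux).
exact: norm2_mulmx_local k0 Hsym Hk h.
Qed.

Lemma local_norm_bounded : exists K : R, forall x, U x -> local_norm P x <= K.
Proof.
have [k k0 kH] := hess_coercive.
exists (Num.sqrt ((m * \sum_i dims P i)%:R * `|A| *
  (k * (((\sum_i dims P i) * m)%:R * `|A^T|)))) => x Ux.
by have [Hsym Hk] := kH x Ux; apply: ler_wsqrtr; exact: opnorm2_local_le.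
Qed.

(** A zero local norm would annihilate every column of [A], against full row rank with [m > 0]. *)
Lemma local_norm_gt0 x : U x -> 0 < local_norm P x.
Proof.
move=> Ux; rewrite lt_neqAle local_norm_ge0 andbT; apply/negP => /eqP c0.
have A0 : A = 0.
  apply/matrixP => i j; have := norm2_mulmx_le_local (delta_mx j ord0) Ux.
  rewrite -c0 mul0r => Aj.
  have /norm2_eq0 : norm2 (A *m (delta_mx j ord0 : 'cV_(\sum_i dims P i))) = 0.
    by apply/eqP; rewrite eq_le Aj norm2_ge0.
  by rewrite -colE => /matrixP/(_ i ord0); rewrite !mxE.
have := A1_rank hA1; rewrite A0 /row_free mxrank0 eq_sym => /eqP m0.
by have := pd_m hP; rewrite m0.
Qed.

(** Co-coercivity of the dual gradient. Each maximizer is tested in the optimality condition of the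
    other; the objective values cancel in the sum, leaving the gradient gap of [F]. That gap is at
    least [r ^+ 2 / (1 + r)] in the local norm [r] of [x' - x], and [d <= c * r]. *)
Lemma xstar_monotone y z t (x := xstar P y t) (x' := xstar P z t)
    (c := local_norm P x) (d := norm2 (resid x' - resid x)) : 0 < t ->
  t * d ^+ 2 <= dotp (z - y) (resid x' - resid x) * (c * (c + d)).
Proof.
move=> t0; have Ux : U x := xstar_interior y t0.
have Ux' : U x' := xstar_interior z t0.
have c0 : 0 < c := local_norm_gt0 Ux.
have d0 : 0 <= d := norm2_ge0 _.
have o1 := xstar_optimality y t0 Ux'.
have o2 := xstar_optimality z t0 Ux.
have dr := norm2_mulmx_le_local (x' - x) Ux.
have mono := barrier_monotone barF Ux Ux'.
rewrite -residB -/d -/c in dr; rewrite -!residB in o1 o2.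
have E : 'D_(x - x') F x' = - 'D_(x' - x) F x'.
  rewrite -opprB -scaleN1r.
  have dF : derivable F x' (x' - x) := Cn_on_derivable (bb_C3 barF) Ux'.
  by rewrite (@derive_val _ _ _ _ _ _ _ (is_derive_dirZ (- 1) dF)) mulN1r.
move: o1 o2; rewrite -/x -/x' E.
have -> : dotp z (resid x - resid x') = - dotp z (resid x' - resid x).
  by rewrite -dotpNr [in RHS]opprB.
have -> : dotp (z - y) (resid x' - resid x) =
    dotp z (resid x' - resid x) - dotp y (resid x' - resid x).
  by rewrite dotpDl dotpNl.
have := sqrtr_ge0 ('D_(x' - x) ('D_(x' - x) F) x).
have := sqr_sqrtr (bb_convexF barF (x' - x) Ux).
move: dr mono; move: ('D_(x' - x) ('D_(x' - x) F) x) (Num.sqrt _) => W r.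
move: ('D_(x' - x) F x) ('D_(x' - x) F x') (dotp y _) (dotp z _)
  (total_obj P x) (total_obj P x') => D D' p q o o'.
move=> dr mono rW r0 o1 o2; rewrite -rW in mono.
have q_ge : t * (r ^+ 2 / (1 + r)) <= q - p.
  apply: le_trans (ler_wpM2l (ltW t0) mono) _; rewrite mulrBr.
  by rewrite mulrN in o2; exact: add_opposite_gaps o1 o2.
have cd0 : 0 <= c * (c + d) by rewrite mulr_ge0 ?addr_ge0// ltW.
apply: le_trans (ler_wpM2r cd0 q_ge).
rewrite -mulrA ler_wpM2l ?(ltW t0)// mulrAC ler_pdivlMr ?ltr_wpDr//.
exact: (sc_step_bound (ltW c0)).
Qed.

End dual.

Lemma squeeze_norm (R : realDomainType) (q a b : R) :
  a <= q -> q <= b -> `|q - a| <= `|b - a|.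
Proof.
move=> aq qb; rewrite !ger0_norm ?subr_ge0 ?(le_trans aq)//.
exact: lerB.
Qed.

Lemma half_weight_bound (R : realFieldType) (a b q v u k n w : R) :
  q - a / 2 <= v -> v <= u -> k <= q - b -> a <= b -> 0 <= w -> - n <= k ->
  a <= 2 * u + 2 * (n + w).
Proof. lra. Qed.

(** * Gradient, descent step and growth of the dual function *)

Section dual_properties.
Variables (R : realType) (m N : nat) (P : sep_problem R m N) (nu : 'I_N -> R)
  (xc : forall i, 'cV[R]_(dims P i)).
Hypotheses (hP : problem_data P) (hA1 : assumption_A1 P)
  (hA2 : assumption_A2 P nu) (hxc : normalized_centers xc).
Local Notation X := (feas_set P).
Local Notation U := (interior (feas_set P)).
Local Notation L := (smoothed_lagr P).
Local Notation F := (total_bar P).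
Local Notation g := (dual_obj P).
Implicit Types (x : 'cV[R]_(\sum_i dims P i)) (y z : 'cV[R]_m) (s t c : R).

Let Uxstar y t (t0 : 0 < t) : U (xstar P y t) :=
  xstar_interior hP hA1 hA2 hxc y t0.
Let subgrad y z t (t0 : 0 < t) := dual_subgradient hP hA1 hA2 hxc y z t0.

Lemma norm2_resid_bounded :
  exists2 B : R, 0 <= B & forall x, X x -> norm2 (resid (P := P) x) <= B.
Proof.
have [B B0 XB] := resid_bounded hA2.
exists (m%:R * B); first by rewrite mulr_ge0.
by move=> x /XB xB; apply: le_trans (norm2_le_mx_norm _) _; rewrite ler_wpM2l.
Qed.

Lemma norm2_resid_diff_bounded : exists2 B : R, 0 <= B &
  forall x x', X x -> X x' -> norm2 (resid x' - resid x) <= B.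
Proof.
have [B B0 XB] := resid_bounded hA2.
exists (m%:R * (B + B)); first by rewrite mulr_ge0// addr_ge0.
move=> x x' Xx Xx'; apply: le_trans (norm2_le_mx_norm _) _; rewrite ler_wpM2l//.
by apply: le_trans (ler_normB _ _) _; rewrite lerD// XB.
Qed.

(** The subgradient inequalities at both ends squeeze the difference quotient between a coordinate
    of the residual at [y] and the same coordinate at the shifted point. Co-coercivity makes these
    differ by at most [K * |h|]. *)
Lemma dual_partial_derivative y t (i : 'I_m) : 0 < t ->
  'D_(delta_mx i ord0) (fun z => g z t) y = resid (xstar P y t) i ord0.
Proof.
move=> t0; have [B B0 XB] := norm2_resid_diff_bounded.
set x := xstar P y t; set c := local_norm P x.
have Ux : U x := Uxstar y t0.
have c0 : 0 < c := local_norm_gt0 hP hA1 hA2 hxc Ux.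
(* Co-coercivity reads [t * d ^+ 2 <= |h| * d * (c * (c + d))] here, and [d <= B]. *)
pose K := c * (c + B) / t.
have K0 : 0 <= K by rewrite divr_ge0 ?mulr_ge0 ?addr_ge0 ?(ltW c0) ?(ltW t0).
have quot h : h != 0 -> `|resid x i ord0 -
    h^-1 * (g (h *: delta_mx i ord0 + y) t - g y t)| <= K * `|h|.
  move=> h0; set z := h *: _ + y; set x' := xstar P z t.
  have Ux' : U x' := Uxstar z t0.
  have zy : z - y = h *: delta_mx i ord0 by rewrite addrK.
  set d := norm2 (resid x' - resid x).
  have d0 : 0 <= d := norm2_ge0 _.
  have dB : d <= B := XB _ _ (interior_subset Ux) (interior_subset Ux').
  have wi : `|resid x' i ord0 - resid x i ord0| <= d.
    apply: le_trans (mx_norm_le_norm2 _).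
    by have := mx_entry_le (resid x' - resid x) i ord0; rewrite !mxE.
  have lo : h * resid x i ord0 <= g z t - g y t.
    have := subgrad y z t0; rewrite zy dotpZl dotpC dotp_delta -lerBrDl.
    exact.
  have hi : g z t - g y t <= h * resid x' i ord0.
    have := subgrad z y t0; rewrite -opprB zy dotpNl dotpZl dotpC dotp_delta.
    by rewrite lerBlDr lerBlDl addrC.
  have dK : d <= K * `|h|.
    have [->|d_neq0] := eqVneq d 0; first by rewrite mulr_ge0.
    have d_gt0 : 0 < d by rewrite lt_neqAle eq_sym d_neq0.
    have := xstar_monotone hP hA1 hA2 hxc y z t0.
    rewrite -/x -/x' -/d -/c zy dotpZl dotpC dotp_delta => mono.
    rewrite /K mulrAC ler_pdivlMr// -(ler_pM2r d_gt0).
    apply: (@le_trans _ _ (t * d ^+ 2)).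
      by rewrite le_eqVlt; apply/orP; left; apply/eqP; ring.
    apply: (le_trans mono).
    apply: (@le_trans _ _ (`|h| * d * (c * (c + d)))).
      rewrite ler_wpM2r ?mulr_ge0 ?addr_ge0 ?(ltW c0)//.
      apply: le_trans (ler_norm _) _; rewrite normrM ler_wpM2l//.
      by move: wi; rewrite !mxE.
    rewrite [leRHS](_ : _ = `|h| * d * (c * (c + B))); last by ring.
    rewrite ler_wpM2l ?mulr_ge0//.
    by rewrite ler_wpM2l ?(ltW c0)// lerD2l.
  apply: le_trans dK; apply: le_trans wi.
  have hn : 0 < `|h| by rewrite normr_gt0.
  rewrite -(ler_pM2l hn) -!normrM mulrBr mulVKf// distrC [in leRHS]mulrBr.
  exact: squeeze_norm.
apply: cvg_lim => //; apply/cvgrPdist_le => e e0.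
have K1 : 0 < K + 1 by rewrite ltr_wpDl.
near=> h.
have h0 : h != 0 by near: h; exact: nbhs_dnbhs_neq.
apply: le_trans (quot h h0) _.
have he : `|h| <= e / (K + 1) by near: h; apply: dnbhs0_le; rewrite divr_gt0.
apply: le_trans (ler_wpM2l K0 he) _.
rewrite mulrCA ger_pMr// ler_pdivrMr// mul1r lerDl.
exact: ler01.
Unshelve. all: by end_near. Qed.

Lemma grad_dualE y t : 0 < t -> grad_dual P y t = resid (xstar P y t).
Proof.
by move=> t0; apply/colP => i; rewrite mxE dual_partial_derivative.
Qed.

(* The step length is exactly the one for which the co-coercivity of the dual
   gradient bounds its variation [d] by its norm [l]. *)
Lemma dual_gradient_step y t (c := local_norm P (xstar P y t))
    (l := norm2 (grad_dual P y t)) : 0 < t ->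
  g (y - (t / (c * (c + l))) *: grad_dual P y t) t <= g y t.
Proof.
move=> t0; set G := grad_dual P y t; set a := t / _; set y' := y - _.
set x := xstar P y t; set x' := xstar P y' t.
have c0 : 0 < c := local_norm_gt0 hP hA1 hA2 hxc (Uxstar y t0).
have l0 : 0 <= l := norm2_ge0 _.
have cl0 : 0 < c + l by rewrite ltr_wpDr.
have a0 : 0 < a by rewrite divr_gt0// mulr_gt0.
have GE : G = resid x := grad_dualE y t0.
set w := resid x' - resid x; set d := norm2 w.
have d0 : 0 <= d := norm2_ge0 _.
have yy' : y' - y = - (a *: G) by rewrite addrAC subrr sub0r.
have Gw : `|dotp G w| <= l * d := Cauchy_Schwarz _ _.
have mono := xstar_monotone hP hA1 hA2 hxc y y' t0.
rewrite -/c -/x -/x' -/w -/d yy' dotpNl dotpZl in mono.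
(* With this [a], co-coercivity simplifies to [d * (c + l) <= l * (c + d)], which is
   [d * c <= l * c]. *)
have dl : d <= l.
  have [->//|d_neq0] := eqVneq d 0.
  have d_gt0 : 0 < d by rewrite lt_neqAle eq_sym d_neq0.
  have : t * d ^+ 2 <= a * (l * d) * (c * (c + d)).
    apply: (le_trans mono); rewrite ler_wpM2r ?mulr_ge0 ?addr_ge0 ?(ltW c0)//.
    rewrite -mulrN ler_wpM2l ?(ltW a0)//.
    by apply: le_trans (ler_norm _) _; rewrite normrN.
  have -> : a * (l * d) * (c * (c + d)) = t * d * (l * (c + d) / (c + l)).
    by rewrite /a; field; rewrite !gt_eqF.
  rewrite expr2 mulrA ler_pM2l ?mulr_gt0// ler_pdivlMr// !mulrDr.
  by rewrite [l * d]mulrC lerD2r ler_pM2r.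
(* The subgradient is taken at the new point [y']; there [dotp G (G + w) >= l ^+ 2 - l * d >= 0]. *)
have := subgrad y' y t0; rewrite -opprB yy' opprK dotpZl -/x'.
have -> : resid x' = G + w by rewrite GE subrKC.
rewrite dotpDr -norm2_sqr -/l => sub; apply: le_trans sub.
rewrite lerDl mulr_ge0 ?(ltW a0)//.
move: Gw; rewrite ler_norml => /andP[Gw _].
rewrite -lerBlDr sub0r; apply: le_trans (_ : _ <= l * d) _.
  by rewrite lerNl.
by rewrite expr2 ler_wpM2l.
Qed.

Lemma dual_convex_along y z t s : 0 < t -> 0 <= s <= 1 ->
  g (y + s *: (z - y)) t <= g y t + s * (g z t - g y t).
Proof.
move=> t0 /andP[s0 s1]; set u := y + _.
have r1 := subgrad u y t0; have r2 := subgrad u z t0.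
have uy : y - u = - (s *: (z - y)) by rewrite opprD addNKr.
have uz : z - u = (1 - s) *: (z - y).
  by rewrite opprD addrA scalerBl scale1r.
move: r1 r2; rewrite uy uz dotpNl !dotpZl.
move: (g u t) (g y t) (g z t) (dotp _ _) => a b c q r1 r2.
have s1' : 0 <= 1 - s by rewrite subr_ge0.
have := ler_wpM2l s1' r1; have := ler_wpM2l s0 r2; lra.
Qed.

Lemma dual_lipschitz t : 0 < t ->
  exists2 B : R, 0 <= B & forall y z, `|g y t - g z t| <= B * `|y - z|.
Proof.
move=> t0; have [B B0 XB] := norm2_resid_bounded.
exists (m%:R * B) => [|y z]; first by rewrite mulr_ge0.
have le1 y1 y2 : g y1 t - g y2 t <= m%:R * B * `|y1 - y2|.
  have := subgrad y1 y2 t0.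
  rewrite -lerBrDl => sub; rewrite -[leLHS]opprB lerNl.
  apply: le_trans sub; rewrite lerNl -dotpNl opprB.
  apply: le_trans (ler_norm _) (le_trans (Cauchy_Schwarz _ _) _).
  rewrite mulrAC; apply: ler_pM; rewrite ?norm2_ge0 ?norm2_le_mx_norm//.
  by apply: XB; exact: interior_subset (Uxstar y1 t0).
by rewrite ler_norml lerNl opprB le1 distrC le1.
Qed.

(** The barrier term has a favourable sign and is dropped, so [M] does not depend on [t]; objective
    and residual are bounded above on the compact set [X]. *)
Lemma dual_upper_bound : exists2 M : R, 0 <= M &
  forall y t, 0 < t -> g y t <= M * (1 + `|y|).
Proof.
have [B B0 XB] := norm2_resid_bounded.
have [x0 [_ maxx0]] : argmax X (total_obj P) !=set0.
  apply: (@usc_max _ _ X) => //.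
  - exact: feas_compact hP hA2.
  - by have [u Uu] := feas_interior_nonempty hxc; exists u; exact: interior_subset.
  move=> z c Xz /(_ Xz) zc.
  apply: (@filterS _ (nbhs z) _ _ _ _ (total_obj_usc hA1 zc)) => x xc' _.
  exact: xc'.
exists (`|total_obj P x0| + m%:R * B) => [|y t t0].
  by rewrite addr_ge0// mulr_ge0.
rewrite (dual_objE hP hA1 hA2 hxc)// smoothed_lagrE.
have Ux := Uxstar y t0; have Xx := interior_subset Ux.
rewrite lerBlDr.
apply: (@le_trans _ _ ((`|total_obj P x0| + m%:R * B) * (1 + `|y|))); last first.
  by rewrite lerDl mulr_ge0 ?(ltW t0)// (total_bar_ge0 hxc).
rewrite mulrDr mulr1 mulrDl -addrA; apply: lerD.
  exact: le_trans (maxx0 _ Xx) (ler_norm _).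
apply: (@le_trans _ _ (m%:R * B * `|y|)).
  apply: le_trans (ler_norm _) (le_trans (Cauchy_Schwarz _ _) _).
  rewrite mulrAC; apply: ler_pM; rewrite ?norm2_ge0 ?norm2_le_mx_norm//.
  exact: XB.
by rewrite addrA lerDr addr_ge0 ?mulr_ge0.
Qed.

(** On the unit sphere around the unique minimizer, compactness gives a gap [c > 0] above the
    minimum; convexity along rays extends it to linear growth outside the ball. *)
Lemma dual_coercive t : 0 < t -> (exists! y, dual_solutions P t y) ->
  exists c C, 0 < c /\ forall y, c * `|y| - C <= g y t.
Proof.
move=> t0 [y0 [[_ miny0] uniq_y0]].
have [B B0 gB] := dual_lipschitz t0.
pose S : set 'cV[R]_m := [set y | `|y - y0| = 1].
have distS : continuous (fun y => `|y - y0|).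
  apply: (@dist_bound_continuous _ _ _ _ 1) => y z; rewrite mul1r.
  apply: le_trans (ler_dist_dist _ _) _.
  by rewrite opprB addrA subrK.
have cS : compact S.
  apply: cV_compact.
    exists (1 + `|y0|); split; first exact: num_real.
    move=> M /ltW M1 y /= y1; apply: le_trans M1.
    by rewrite -[y in `|y|](subrK y0) (le_trans (ler_normD _ _))// y1.
  have /continuous_closedP /(_ _ (@closed_eq R 1)) := distS.
  exact.
(* A unit vector exists because [m > 0]. *)
have S0 : S !=set0.
  have i0 : 'I_m := Ordinal (pd_m hP).
  exists (y0 + const_mx 1); rewrite /S /= addrAC subrr add0r.
  apply/eqP; rewrite eq_le mx_norm_leP//= => [|i j]; last by rewrite mxE normr1.
  by have := mx_entry_le (const_mx 1 : 'cV[R]_m) i0 ord0; rewrite mxE normr1.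
have cg : {within S, continuous (fun y => g y t)}.
  apply: continuous_subspaceT; exact: dist_bound_continuous gB.
have [ys /[!inE] Sys minS] := compact_EVT_min S0 cS cg.
pose c := g ys t - g y0 t.
have c0 : 0 < c.
  rewrite subr_gt0 lt_neqAle miny0// andbT; apply/eqP => E.
  have ysE : y0 = ys.
    by apply: uniq_y0; split=> // z _; rewrite -E; exact: miny0.
  move: Sys; rewrite /S /= -ysE subrr normr0 => /esym/eqP.
  by rewrite oner_eq0.
have lower y : c * (`|y - y0| - 1) <= g y t - g y0 t.
  have [y1|y1] := leP `|y - y0| 1.
    apply: (@le_trans _ _ 0); first by rewrite mulr_ge0_le0 ?(ltW c0)// subr_le0.
    by rewrite subr_ge0 miny0.
  set r := `|y - y0| in y1 *.
  have r0 : 0 < r := lt_trans ltr01 y1.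
  have s01 : 0 <= r^-1 <= 1 by rewrite invr_ge0 (ltW r0) invf_le1// ltW.
  have := dual_convex_along y0 y t0 s01.
  have Sp : S (y0 + r^-1 *: (y - y0)).
    by rewrite /S /= addrAC subrr add0r normrZ gtr0_norm ?invr_gt0// mulVf ?gt_eqF.
  have := minS _ (mem_set Sp) => le1 le2.
  have : c <= r^-1 * (g y t - g y0 t) by rewrite lerBlDl (le_trans le1).
  rewrite mulrC ler_pdivlMr// => le3; apply: le_trans le3.
  by rewrite ler_pM2l// lerBlDr lerDl.
exists c, (c * `|y0| + c - g y0 t); split=> // y.
have := lower y; rewrite lerBrDr; apply: le_trans.
have : `|y| - `|y0| <= `|y - y0| := lerB_dist _ _.
move=> /(ler_wpM2l (ltW c0)); lra.
Qed.

(* [g y] is a supremum of affine functions of the weight, with slopes [- F x]: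
   evaluating the one attained at [t'] at the weight [tmin / 2] bounds its slope
   by the growth of [g]. *)
Lemma total_bar_xstar_bound t : 0 < t -> (exists y, dual_solutions P t y) ->
  exists2 K : R, 0 <= K & forall y t' tmin, 0 < tmin -> tmin <= t' -> t' <= t ->
    tmin * F (xstar P y t') <= K * (1 + `|y|).
Proof.
move=> t0 [y0 [_ miny0]]; have [M M0 gM] := dual_upper_bound.
exists (2 * (M + `|g y0 t|)); first by rewrite mulr_ge0// addr_ge0.
move=> y t' tm tm0 tmt' t't.
have t'0 := lt_le_trans tm0 tmt'.
have tm2 : 0 < tm / 2 by rewrite divr_gt0.
have Ux := Uxstar y t'0; set x := xstar P y t' in Ux *.
have F0 : 0 <= F x := total_bar_ge0 hxc Ux.
have h1 := smoothed_lagr_le_dual hP hA1 hA2 hxc y tm2 Ux.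
have h2 := gM y _ tm2.
(* The lower bound on [g y t'] comes from the minimum at the larger weight [t], so it is uniform in
   [y] and [t']. *)
have h3 : g y0 t <= g y t' :=
  le_trans (miny0 y I) (dual_antitone hP hA1 hA2 hxc y t'0 t't).
rewrite (dual_objE hP hA1 hA2 hxc y t'0) smoothed_lagrE -/x in h3.
rewrite smoothed_lagrE in h1.
have h4 : tm * F x <= t' * F x by rewrite ler_wpM2r.
have y1 : 0 <= `|g y0 t| * `|y| by rewrite mulr_ge0.
have h5 : - `|g y0 t| <= g y0 t by rewrite lerNl -normrN ler_norm.
have -> : 2 * (M + `|g y0 t|) * (1 + `|y|) = 2 * (M * (1 + `|y|)) +
  2 * (`|g y0 t| + `|g y0 t| * `|y|) by ring.
have h6 : tm / 2 * F x = tm * F x / 2 by ring.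
rewrite h6 in h1; exact: (half_weight_bound h1 h2 h3 h4 y1 h5).
Qed.

End dual_properties.

(** * The algorithm *)

(* From ln (1 + u) = 2 ln (sqrt (1 + u)) <= 2 (sqrt (1 + u) - 1). *)
Lemma sc_omega_lower (R : realType) (u : R) : 0 <= u ->
  (Num.sqrt (1 + u) - 1) ^+ 2 <= sc_omega u.
Proof.
move=> u0; have u1 : 0 < 1 + u by rewrite ltr_pwDl.
have r0 : 0 < Num.sqrt (1 + u) by rewrite sqrtr_gt0.
have ln2 : ln (1 + u) <= 2 * (Num.sqrt (1 + u) - 1).
  rewrite -[X in ln X]sqr_sqrtr ?(ltW u1)// lnXn// mulr_natl lerMn2r/=.
  have := @le_ln1Dx R (Num.sqrt (1 + u) - 1); rewrite subrKC; apply.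
  by rewrite ltrBrDl subrr.
have := sqr_sqrtr (ltW u1); rewrite /sc_omega.
move: ln2; move: (ln _) (Num.sqrt _) => l r ln2 E.
have -> : (r - 1) ^+ 2 = r ^+ 2 - 2 * (r - 1) - 1 by ring.
rewrite E; lra.
Qed.

Lemma sc_omega_ge0 (R : realType) (u : R) : 0 <= u -> 0 <= sc_omega u.
Proof. by move=> u0; exact: le_trans (sqr_ge0 _) (sc_omega_lower u0). Qed.

(** The lower bound on [sc_omega] gives [Num.sqrt (1 + u) <= 1 + Num.sqrt (sc_omega u)]; squaring
    yields the claim, which turns convergence of omega to 0 into convergence of its argument. *)
Lemma le_sc_omega (R : realType) (u : R) : 0 <= u ->
  u <= 2 * Num.sqrt (sc_omega u) + sc_omega u.
Proof.
move=> u0; have w0 := sc_omega_ge0 u0.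
have u1 : 0 <= 1 + u by rewrite addr_ge0.
have r1 : 0 <= Num.sqrt (1 + u) - 1.
  by rewrite subr_ge0 -[leLHS]sqrtr1 ler_wsqrtr// lerDl.
have le_r : Num.sqrt (1 + u) <= 1 + Num.sqrt (sc_omega u).
  rewrite -lerBlDl -[leLHS]ger0_norm// -sqrtr_sqr ler_wsqrtr//.
  exact: sc_omega_lower.
have : Num.sqrt (1 + u) ^+ 2 <= (1 + Num.sqrt (sc_omega u)) ^+ 2.
  by rewrite ler_sqr ?nnegrE ?sqrtr_ge0// addr_ge0 ?sqrtr_ge0.
rewrite sqrrD expr1n mul1r !sqr_sqrtr// -mulr_natl.
by rewrite -addrA lerD2l.
Qed.

(** The equation reads [(1 - 2 * sg) * w = 2 * sg * f], and the factor on the left is at least one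
    half. *)
Lemma omega_le_of_sigma (R : realFieldType) (sg w f C : R) :
  0 <= sg -> sg <= 4^-1 -> w = 2 * sg * (w + f) -> 0 <= w -> 0 <= f ->
  f <= C -> w <= 4 * C * sg.
Proof.
move=> sg0 sg4 wE w0 f0 fC.
have h1 : sg * w <= 4^-1 * w by rewrite ler_wpM2r.
have h2 : sg * f <= sg * C by rewrite ler_wpM2l.
move: wE; rewrite mulrDr -!mulrA [C * sg]mulrC; lra.
Qed.

Lemma cluster_bound (R : realFieldType) (gy gt gz d o p q tF t'F e : R) :
  gy + d <= gt -> gt <= gz -> o + q - tF <= gy -> - (e / 3) <= d ->
  tF - t'F <= e / 3 -> p - q < e / 3 -> o + p - t'F <= e + gz.
Proof. lra. Qed.

Section run.
Variables (R : realType) (m N : nat) (P : sep_problem R m N) (nu : 'I_N -> R)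
  (xc : forall i, 'cV[R]_(dims P i)) (s : pf_run P).
Hypotheses (hP : problem_data P) (hA1 : assumption_A1 P)
  (hA2 : assumption_A2 P nu) (hxc : normalized_centers xc)
  (hdual : forall t : R, 0 < t -> exists! y, dual_solutions P t y)
  (hinf : 0 < inf (range (run_t s))).
Local Notation U := (interior (feas_set P)).
Local Notation F := (total_bar P).
Local Notation g := (dual_obj P).
Local Notation y := (run_y s).
Local Notation t := (run_t s).
Local Notation tinf := (inf (range (run_t s))).

Lemma run_x_interior k : 0 < t k -> U (run_x s k).
Proof.
case: k => [|k] tk; first by rewrite run_x0; exact: xstar_interior hP hA1 hA2 hxc _ _ tk.
by rewrite run_xS; exact: xstar_interior hP hA1 hA2 hxc _ _ tk.
Qed.

Lemma run_cF_ge0 k : 0 < t k -> 0 <= run_cF s k.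
Proof.
by move=> /run_x_interior Ux; rewrite run_cFE (total_bar_ge0 hxc).
Qed.

Lemma run_cA_gt0 k : 0 < t k -> 0 < run_cA s k.
Proof.
by move=> /run_x_interior Ux; rewrite run_cAE (local_norm_gt0 hP hA1 hA2 hxc).
Qed.

Lemma run_lambda_ge0 k : 0 <= run_lambda s k.
Proof. by case: k => [|k]; rewrite ?run_lambda0 ?run_lambdaS norm2_ge0. Qed.

Lemma run_omega_ge0 k : 0 < t k -> 0 <= run_omega s k.
Proof.
move=> /run_cA_gt0 c0; rewrite run_omegaE sc_omega_ge0// divr_ge0//.
  exact: run_lambda_ge0.
exact: ltW.
Qed.

Lemma run_sigma_bounds k : 0 < t k -> 0 <= run_sigma s k <= 2^-1.
Proof.
move=> tk; have w0 := run_omega_ge0 tk; have c0 := run_cF_ge0 tk.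
have d0 : 0 <= run_omega s k + run_cF s k by rewrite addr_ge0.
rewrite run_sigmaE divr_ge0 ?mulr_ge0//=.
(* A zero denominator gives [run_sigma s k = 0], since the inverse of 0 is 0. *)
have [d1|d_neq0] := eqVneq (run_omega s k + run_cF s k) 0.
  by rewrite d1 mulr0 invr0 mulr0 invr_ge0.
have d_gt0 : 0 < run_omega s k + run_cF s k by rewrite lt_neqAle eq_sym d_neq0.
rewrite ler_pdivrMr ?mulr_gt0// mulrA mulVf ?pnatr_eq0// mul1r.
by rewrite lerDl.
Qed.

(** The bound [sigma <= 1 / 2] at step [k] itself relies on [0 < t k], so positivity is carried by
    induction and is a premise of the preceding lemmas. *)
Lemma run_t_gt0 k : 0 < t k.
Proof.
elim: k => [|k tk]; first exact: run_t0.
have /andP[_ sk] := run_sigma_bounds tk.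
by rewrite run_tS mulr_gt0// subr_gt0 (le_lt_trans sk)// invf_lt1// ltr1n.
Qed.

Lemma run_t_nonincreasing : {homo t : i j / (i <= j)%N >-> j <= i}.
Proof.
apply/nonincreasing_seqP => k; have tk := run_t_gt0 k.
have /andP[sk _] := run_sigma_bounds tk.
by rewrite run_tS ler_piMr ?(ltW tk)// gerBl.
Qed.

Lemma run_t_lbound : has_lbound (range t).
Proof. by exists 0 => _ [k _ <-]; exact: ltW (run_t_gt0 k). Qed.

Lemma tinf_le k : tinf <= t k.
Proof. by apply: ge_inf; [exact: run_t_lbound|exists k]. Qed.

Lemma run_t_cvg : t @ \oo --> tinf.
Proof.
apply: nonincreasing_cvgn; [exact: run_t_nonincreasing|exact: run_t_lbound].
Qed.

Lemma run_lambda_resid k :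
  run_lambda s k.+1 = norm2 (resid (xstar P (y k) (t k.+1))).
Proof.
by rewrite run_lambdaS (grad_dualE hP hA1 hA2 hxc _ (run_t_gt0 k.+1)).
Qed.

Lemma run_dual_step k :
  g (y k.+1) (t k.+1) <= g (y k) (t k) + (t k - t k.+1) * F (run_x s k.+1).
Proof.
have tk := run_t_gt0 k.+1.
apply: (@le_trans _ _ (g (y k) (t k.+1))).
  rewrite run_yS run_alphaS run_cAE run_xS run_lambdaS.
  exact: dual_gradient_step hP hA1 hA2 hxc _ _ tk.
(* The maximizer for the weight [t k.+1] is a candidate for [t k]; the two Lagrangians differ there
   by the weight difference times [F]. *)
have Ux := run_x_interior tk.
have := smoothed_lagr_le_dual hP hA1 hA2 hxc (y k) (run_t_gt0 k) Ux.
rewrite (dual_objE hP hA1 hA2 hxc (y k) tk) -run_xS !smoothed_lagrE mulrBl.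
move: (t k * _) (t k.+1 * _) => a b.
move: (total_obj _ _ + _) (dual_obj _ _ _) => q v; lra.
Qed.

(* Gronwall on [H k = g (y k) (t k) + C + c], which dominates
   [c (1 + |y k|)]. *)
Lemma run_y_bounded : exists2 Y : R, 0 <= Y & forall k, `|y k| <= Y.
Proof.
have t0 := run_t_gt0 0.
have [c [C [c0 coer]]] := dual_coercive hP hA1 hA2 hxc t0 (hdual t0).
have [K K0 Fbound] : exists2 K : R, 0 <= K & forall z t' tm, 0 < tm ->
    tm <= t' -> t' <= t 0 -> tm * F (xstar P z t') <= K * (1 + `|z|).
  apply: (total_bar_xstar_bound hP hA1 hA2 hxc t0).
  by have [z [dz _]] := hdual t0; exists z.
pose H k := g (y k) (t k) + C + c.
have Hy k : c * (1 + `|y k|) <= H k.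
  have := le_trans (coer (y k)) (dual_antitone hP hA1 hA2 hxc (y k)
    (run_t_gt0 k) (run_t_nonincreasing (leq0n k))).
  by rewrite lerBlDr /H mulrDr mulr1 [c + _]addrC lerD2r.
have H0 k : 0 <= H k.
  by apply: le_trans (Hy k); rewrite mulr_ge0 ?(ltW c0)// addr_ge0.
(* From [tinf * F <= K * (1 + |y k|)] and [c * (1 + |y k|) <= H k] one gets [F <= D * H k]. *)
pose D := K / (c * tinf).
have D0 : 0 <= D by rewrite divr_ge0// mulr_ge0 ?ltW.
have Hstep k : H k.+1 <= H k * (1 + D * (t k - t k.+1)).
  have dt0 : 0 <= t k - t k.+1 by rewrite subr_ge0 run_t_nonincreasing.
  have Fk : F (run_x s k.+1) <= D * H k.
    have := Fbound (y k) (t k.+1) tinf hinf (tinf_le k.+1)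
      (run_t_nonincreasing (leq0n k.+1)).
    rewrite -run_xS -ler_pdivlMl// => Fk; apply: (le_trans Fk).
    rewrite /D mulrA [leRHS](_ : _ = tinf^-1 * K * (c^-1 * H k)); last first.
      by field; rewrite !gt_eqF.
    by rewrite ler_wpM2l ?mulr_ge0 ?invr_ge0 ?(ltW hinf)// ler_pdivlMl.
  have -> : H k * (1 + D * (t k - t k.+1)) = H k + (t k - t k.+1) * (D * H k).
    by ring.
  apply: (le_trans _ (lerD (lexx (H k)) (ler_wpM2l dt0 Fk))).
  have := run_dual_step k; rewrite /H; move: (_ * F _) => b.
  move: (g _ _) (g (y k) _) => v v' vb.
  by rewrite (addrAC (v' + C)) (addrAC v') !lerD2r.
(* Each factor [1 + D * (t k - t k.+1)] is at most its exponential, and the exponents telescope. *)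
have Hk k : H k <= H 0%N * expR (D * (t 0 - t k)).
  elim: k => [|k IH]; first by rewrite subrr mulr0 expR0 mulr1.
  apply: le_trans (Hstep k) _.
  have dt0 : 0 <= t k - t k.+1 by rewrite subr_ge0 run_t_nonincreasing.
  apply: (@le_trans _ _ (H 0%N * expR (D * (t 0 - t k)) *
      expR (D * (t k - t k.+1)))).
    by apply: ler_pM => //; [rewrite addr_ge0// mulr_ge0|exact: expR_ge1Dx].
  by rewrite -mulrA -expRD -mulrDr addrA subrK.
have E0 : 0 <= H 0%N * expR (D * t 0).
  by rewrite mulr_ge0// expR_ge0.
exists (c^-1 * (H 0%N * expR (D * t 0))) => [|k].
  by rewrite mulr_ge0// invr_ge0 ltW.
rewrite ler_pdivlMl//; apply: (@le_trans _ _ (c * (1 + `|y k|))).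
  by rewrite ler_wpM2l ?(ltW c0)// lerDr.
apply: le_trans (Hy k) (le_trans (Hk k) _).
rewrite ler_wpM2l// ler_expR ler_wpM2l// gerBl.
exact: ltW (run_t_gt0 k).
Qed.

Lemma run_cF_bounded : exists2 C : R, 0 <= C & forall k, run_cF s k.+1 <= C.
Proof.
have t0 := run_t_gt0 0; have [Y Y0 yY] := run_y_bounded.
have [K K0 Fbound] : exists2 K : R, 0 <= K & forall z t' tm, 0 < tm ->
    tm <= t' -> t' <= t 0 -> tm * F (xstar P z t') <= K * (1 + `|z|).
  apply: (total_bar_xstar_bound hP hA1 hA2 hxc t0).
  by have [z [dz _]] := hdual t0; exists z.
exists (tinf^-1 * (K * (1 + Y))) => [|k].
  by rewrite mulr_ge0 ?invr_ge0 ?(ltW hinf)// mulr_ge0// addr_ge0.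
rewrite run_cFE run_xS ler_pdivlMl//.
apply: le_trans (Fbound (y k) (t k.+1) tinf hinf (tinf_le k.+1)
  (run_t_nonincreasing (leq0n k.+1))) _.
by rewrite ler_wpM2l// lerD2l.
Qed.

Lemma run_sigma_cvg : run_sigma s k @[k --> \oo] --> (0 : R).
Proof.
have sE k : run_sigma s k = 1 - t k.+1 / t k.
  by rewrite run_tS; field; rewrite gt_eqF// run_t_gt0.
under eq_fun do rewrite sE.
have -> : 0 = 1 - tinf / tinf :> R by rewrite divff ?subrr// gt_eqF.
apply: cvgB; first exact: cvg_cst.
apply: cvgM; first by have := run_t_cvg; rewrite -cvg_shiftS.
by apply: cvgV; [rewrite gt_eqF|exact: run_t_cvg].
Qed.

Lemma run_omega_cvg : run_omega s k.+1 @[k --> \oo] --> (0 : R).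
Proof.
have [C C0 cF] := run_cF_bounded.
have sig : run_sigma s k.+1 @[k --> \oo] --> (0 : R).
  by have := run_sigma_cvg; rewrite -cvg_shiftS.
apply: (@squeeze_cvgr _ _ _ _ (fun=> 0) (fun k => 4 * C * run_sigma s k.+1)).
- near=> k.
  have tk := run_t_gt0 k.+1.
  have w0 := run_omega_ge0 tk; have c0 := run_cF_ge0 tk.
  have /andP[s0 _] := run_sigma_bounds tk.
  have s4 : run_sigma s k.+1 <= 4^-1.
    by near: k; apply: (cvgr_le 0 sig); rewrite invr_gt0.
  have wE : run_omega s k.+1 =
      2 * run_sigma s k.+1 * (run_omega s k.+1 + run_cF s k.+1).
    (* If the denominator vanishes, both nonnegative summands do, so the identity still holds. *)
    have [d0|d_neq0] := eqVneq (run_omega s k.+1 + run_cF s k.+1) 0.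
      rewrite d0 mulr0; apply/eqP; rewrite eq_le w0 andbT -d0.
      by rewrite lerDl.
    by rewrite run_sigmaE; field.
  rewrite w0/=; have := cF k.
  move: s0 s4 wE w0 c0.
  move: (run_sigma s k.+1) (run_omega s k.+1) (run_cF s k.+1) => sg w f.
  exact: omega_le_of_sigma.
- exact: cvg_cst.
- by rewrite -[X in _ --> X](mulr0 (4 * C)); apply: cvgMr.
Unshelve. all: by end_near. Qed.

Lemma run_lambda_cvg : run_lambda s k.+1 @[k --> \oo] --> (0 : R).
Proof.
have [K cK] := local_norm_bounded hP hA2 hxc.
(* [le_sc_omega] at [lambda / c_A], multiplied by [c_A <= |K|]. *)
pose h k := `|K| * (2 * Num.sqrt (run_omega s k.+1) + run_omega s k.+1).
apply: (@squeeze_cvgr _ _ _ _ (fun=> 0) h).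
- near=> k; rewrite run_lambda_ge0/=.
  have tk := run_t_gt0 k.+1; have c0 := run_cA_gt0 tk.
  have l0 := run_lambda_ge0 k.+1.
  have u0 : 0 <= run_lambda s k.+1 / run_cA s k.+1 by rewrite divr_ge0// ltW.
  have := le_sc_omega u0; rewrite -run_omegaE ler_pdivrMr// mulrC => /le_trans; apply.
  rewrite /h ler_wpM2r//.
    by rewrite addr_ge0 ?mulr_ge0 ?sqrtr_ge0 ?run_omega_ge0.
  by rewrite run_cAE (le_trans (cK _ (run_x_interior tk)))// ler_norm.
- exact: cvg_cst.
- have sq : Num.sqrt (run_omega s k.+1) @[k --> \oo] --> (0 : R).
    rewrite -[X in _ --> X]sqrtr0; apply: continuous_cvg; last exact: run_omega_cvg.
    exact: sqrt_continuous.
  have -> : 0 = `|K| * (2 * 0 + 0) :> R by rewrite mulr0 addr0 mulr0.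
  apply: cvgMr; apply: cvgD; last exact: run_omega_cvg.
  exact: cvgMr.
Unshelve. all: by end_near. Qed.

(** With [x] fixed as the maximizer at [ystar] and [tinf], its Lagrangian at [y k] and [t k.+1]
    bounds the dual value there from below, and the subgradient inequality compares this value with
    [z]. Three errors of [e / 3] remain: the gradient term, the change of weight, and the passage
    from [y k] to [ystar]. *)
Lemma run_cluster_solution ystar : cluster (y k @[k --> \oo]) ystar ->
  dual_solutions P tinf ystar.
Proof.
move=> cl; split=> // z _.
have [Y Y0 yY] := run_y_bounded.
rewrite (dual_objE hP hA1 hA2 hxc _ hinf).
set x := xstar P ystar tinf.
have Ux : U x := xstar_interior hP hA1 hA2 hxc ystar hinf.
have F0 : 0 <= F x := total_bar_ge0 hxc Ux.
apply/ler_addgt0Pl => e e0.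
have e3 : 0 < e / 3 by rewrite divr_gt0.
pose M := m%:R * (`|z| + Y).
have M0 : 0 <= M by rewrite mulr_ge0 ?addr_ge0.
have eF : 0 < e / 3 / (F x + 1) by rewrite divr_gt0// ltr_wpDl.
have eM : 0 < e / 3 / (M + 1) by rewrite divr_gt0// ltr_wpDl.
(* [A] holds eventually along the iterates, so clustering gives one index [k] at which all three
   errors are small. *)
pose A := [set v | exists k, [/\ v = y k, t k.+1 - tinf <= e / 3 / (F x + 1) &
  run_lambda s k.+1 <= e / 3 / (M + 1)]].
have tS : t k.+1 @[k --> \oo] --> tinf.
  by have := run_t_cvg; rewrite -cvg_shiftS.
have FA : (y k @[k --> \oo]) A.
  rewrite /fmap /=; near=> k; exists k; split=> //.
    rewrite lerBlDr addrC; near: k; apply: (cvgr_le tinf tS).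
    by rewrite ltrDl.
  by near: k; apply: (cvgr_le 0 run_lambda_cvg).
have nB : \forall v \near ystar,
    `|dotp ystar (resid x) - dotp v (resid x)| < e / 3.
  apply: continuous_near_dist e3.
  apply: (@dist_bound_continuous _ _ _ _ (m%:R * norm2 (resid x))) => u v.
  rewrite -dotpNl -dotpDl; apply: le_trans (Cauchy_Schwarz _ _) _.
  by rewrite mulrAC ler_wpM2r ?norm2_ge0// norm2_le_mx_norm.
have [_ [[k [-> tk lk]] yk]] := cl _ _ FA nB.
have tk0 := run_t_gt0 k.+1.
have h1 := dual_subgradient hP hA1 hA2 hxc (y k) z tk0.
have h2 := dual_antitone hP hA1 hA2 hxc z hinf (tinf_le k.+1).
have h3 := smoothed_lagr_le_dual hP hA1 hA2 hxc (y k) tk0 Ux.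
have h4 : - (e / 3) <= dotp (z - y k) (resid (xstar P (y k) (t k.+1))).
  suff : `|dotp (z - y k) (resid (xstar P (y k) (t k.+1)))| <= e / 3.
    by rewrite ler_norml => /andP[].
  apply: le_trans (Cauchy_Schwarz _ _) _; rewrite -run_lambda_resid.
  apply: (@le_trans _ _ (M * (e / 3 / (M + 1)))).
    apply: ler_pM; rewrite ?norm2_ge0 ?run_lambda_ge0//.
    apply: le_trans (norm2_le_mx_norm _) _; rewrite ler_wpM2l//.
    by apply: le_trans (ler_normB _ _) _; rewrite lerD2l.
  by rewrite mulrCA ger_pMr// ler_pdivrMr ?mul1r ?lerDl ?ltr_wpDl.
have h5 : (t k.+1 - tinf) * F x <= e / 3.
  apply: le_trans (ler_wpM2r F0 tk) _.
  by rewrite mulrAC -mulrA ger_pMr// ler_pdivrMr ?mul1r ?lerDl ?ltr_wpDl.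
move: yk; rewrite /= ltr_norml => /andP[_ h6].
move: h3; rewrite !smoothed_lagrE => h3.
rewrite mulrBl in h5.
exact: (cluster_bound h1 h2 h3 h4 h5 h6).
Unshelve. all: by end_near. Qed.

End run.

Theorem theorem1 (R : realType) (m N : nat) (P : sep_problem R m N)
    (nu : 'I_N -> R) (xc : forall i, 'cV[R]_(dims P i)) (s : pf_run P)
    (hP : problem_data P)
    (hA1 : assumption_A1 P)
    (hA2 : assumption_A2 P nu)
    (hxc : normalized_centers xc)
    (hdual : forall t : R, 0 < t -> exists! y, dual_solutions P t y)
    (hinf : 0 < inf (range (run_t s))) :
  norm2 (grad_dual P (run_y s k) (run_t s k.+1)) @[k --> \oo] --> (0 : R) /\
  exists2 ystar : 'cV[R]_m,
    cluster (run_y s k @[k --> \oo]) ystar &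
    dual_solutions P (inf (range (run_t s))) ystar.
Proof.
split.
  under eq_fun do rewrite -run_lambdaS.
  exact: run_lambda_cvg hP hA1 hA2 hxc hdual hinf.
have [Y Y0 yY] := run_y_bounded hP hA1 hA2 hxc hdual hinf.
have cK : compact [set v : 'cV[R]_m | `|v| <= Y].
  apply: cV_compact.
    exists Y; split; first exact: num_real.
    by move=> M /ltW YM v /= vY; exact: le_trans YM.
  have /continuous_closedP/(_ _ (@closed_le R Y)) := @norm_continuous R 'cV[R]_m.
  exact.
have [|ystar [_ cl]] := cK (run_y s k @[k --> \oo]) _.
  by rewrite /fmap /=; near=> k; exact: yY.
exists ystar => //.
exact: (run_cluster_solution hP hA1 hA2 hxc hdual hinf cl).
Unshelve. all: by end_near. Qed.
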